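(* For every integer $n\ge1$, let $CSSC(2n)$ be the number of lozenge tilings of the regular hexagon $H(2n,2n,2n)$ that are invariant both under rotation by $120^\circ$ and under rotation by $180^\circ$ around its center. Then $$CSSC(2n)=\left(\prod_{i=0}^{n-1}\frac{(3i+1)!}{(n+i)!}\right)^2.$$
   Context: Work in the regular triangular lattice with unit side. $H(a,b,c)$ is the lattice hexagon with all angles $120^\circ$ and side lengths $a,b,c,a,b,c$ in cyclic order. A lozenge is a unit rhombus that is the union of two unit triangles of the lattice sharing an edge; a lozenge tiling of the hexagon is a covering of it by lozenges contained in it, without gaps or overlaps. (Such tilings invariant under both rotations correspond to cyclically symmetric self-complementary plane partitions contained in a $2n\times2n\times2n$ box.) *)

(* Defs.v *)
From mathcomp Require Import all_boot all_order all_algebra.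
From mathcomp Require Import finmap.

Set Implicit Arguments.
Unset Strict Implicit.
Unset Printing Implicit Defensive.

Import GRing.Theory Num.Theory.

Local Open Scope fset_scope.
Local Open Scope ring_scope.

(* (x, y) stands for the lattice point x + y w of the complex plane, where
   w = exp(i pi / 3). *)
Definition point := (int * int)%type.

(* |x + y w|^2 = x^2 + x y + y^2. *)
Definition sqdist (p q : point) : int :=
  let d := p - q in d.1 ^+ 2 + d.1 * d.2 + d.2 ^+ 2.

(* Triangles are given by their three vertices, lozenges by the two unit
   triangles they consist of, tilings by their lozenges. *)
Definition triangle := {fset point}.
Definition lozenge := {fset triangle}.
Definition tiling := {fset lozenge}.

Definition is_unit_triangle (t : triangle) : bool :=
  (#|` t| == 3)%N &&
  [forall p : t, forall q : t,
     (val p != val q) ==> (sqdist (val p) (val q) == 1)].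

Definition is_lozenge (l : lozenge) : bool :=
  [exists t : l, exists u : l,
     [&& l == [fset val t; val u],
         is_unit_triangle (val t), is_unit_triangle (val u)
       & (#|` val t `&` val u| == 2)%N]].

(* The lattice points of the hexagon H(a, b, c) placed with one vertex at the
   origin, whose boundary successively makes a steps 1, b steps w, c steps
   w^2 = w - 1, a steps -1, b steps -w and c steps -w^2. Its vertices are
   (0, 0), (a, 0), (a, b), (a - c, b + c), (-c, b + c) and (-c, c). *)
Definition hexagon_points (a b c : nat) : {fset point} :=
  [fset p in [fset (i%:Z - c%:Z, j%:Z) | i in iota 0 (a + c).+1,
                                         j in iota 0 (b + c).+1]
   | 0 <= p.1 + p.2 <= (a + b)%:Z].

Definition hexagon (a b c : nat) : {fset triangle} :=
  [fset t in fpowerset (hexagon_points a b c) | is_unit_triangle t].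

Definition is_tiling (R : {fset triangle}) (T : tiling) : bool :=
  [&& [forall l : T, is_lozenge (val l)], trivIfset T & fcover T == R].

Definition tilings (R : {fset triangle}) : {fset tiling} :=
  [fset T in fpowerset (fpowerset R) | is_tiling R T].

(* Multiplication by w: w (x + y w) = x w + y (w - 1). *)
Definition mulw (p : point) : point := (- p.2, p.1 + p.2).

(* Rotation by k * 60 degrees around o. *)
Definition rot_point (o : point) (k : nat) (p : point) : point :=
  o + iter k mulw (p - o).

Definition rot_triangle (o : point) (k : nat) (t : triangle) : triangle :=
  [fset rot_point o k p | p in t].
Definition rot_lozenge (o : point) (k : nat) (l : lozenge) : lozenge :=
  [fset rot_triangle o k t | t in l].
Definition rot_tiling (o : point) (k : nat) (T : tiling) : tiling :=
  [fset rot_lozenge o k l | l in T].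

(* The midpoint of the opposite vertices (0, 0) and (0, 2 m) of H(m, m, m). *)
Definition hexagon_center (m : nat) : point := (0, m%:Z).

Definition CSSC (m : nat) : nat :=
  #|` [fset T in tilings (hexagon m m m)
       | (rot_tiling (hexagon_center m) 2 T == T)
         && (rot_tiling (hexagon_center m) 3 T == T)]|.

(* Main.v *)
(** Rotation by 60 degrees turns the hexagon into a cone over one sextant, and an
    invariant tiling amounts to choosing, for every upward triangle of the sextant,
    which of its three edges is covered by a lozenge.  Read the sextant ring by ring
    around its apex, and call an outer edge of a ring a particle if it is not covered.
    Passing to the next inner ring, each particle keeps its position or moves one step
    down, particles never collide, and the two extreme particles may leave together
    through the seam of the cone.  Hence the number of fillings inside a given
    configuration of particles satisfies the recursion of a Pfaffian: moves correspond
    to multilinearity, forbidden collisions to the alternating property, and the joint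
    exit to a term of the expansion along the first row.

    In suitable coordinates the skew form is
    [beta(f, g) = <f(1 - X), g> - <f, g(1 - X)>], where [<,>] pairs coefficients.
    Polynomials that are all invariant, or all anti-invariant, under [X -> 1 - X] span
    isotropic subspaces, so in the basis [X^k (1 - X)^k], [(1 - 2X) X^k (1 - X)^k] the
    Pfaffian becomes the determinant of
    [C(k+l+1, 2k-l) + C(k+l, 2k-l-1) = (3k+1) (k+l)! / ((2k-l)! (2l-k+1)!)].
    This is, up to the row factors, an instance of the Andrews-Burge determinant
    [(x+y+i+j-1)! / ((x+2i-j)! (y+2j-i)!)], which is evaluated by condensation: deleting
    the first row or column only shifts [(x, y)] to [(x+2, y-1)] or [(x-1, y+2)]. *)

Require Import Defs.
From mathcomp Require Import all_boot all_order all_algebra all_fingroup.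
From mathcomp Require Import finmap zify ring lra.

Set Implicit Arguments.
Unset Strict Implicit.
Unset Printing Implicit Defensive.

Import Order.TTheory GRing.Theory Num.Theory.

Local Open Scope ring_scope.

(** * Alternating multilinear functions of lists *)

Section Alternating.
Variables (R : comNzRingType) (V : lmodType R).
Implicit Types (g : V -> R) (Phi : seq V -> R) (s t : seq V).

Definition alternating Phi :=
  forall s1 x s2, Phi (s1 ++ x :: x :: s2) = 0.

Definition multilinear Phi := forall s1 a x y s2,
  Phi (s1 ++ (a *: x + y) :: s2) = a * Phi (s1 ++ x :: s2) + Phi (s1 ++ y :: s2).

Lemma multilinearD Phi s1 x y s2 : multilinear Phi ->
  Phi (s1 ++ (x + y) :: s2) = Phi (s1 ++ x :: s2) + Phi (s1 ++ y :: s2).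
Proof. by move=> lin; rewrite -{1}[x]scale1r lin mul1r. Qed.

Lemma multilinear0 Phi s1 s2 : multilinear Phi -> Phi (s1 ++ 0 :: s2) = 0.
Proof.
move=> lin; have := lin s1 (-1) 0 0 s2.
by rewrite scaler0 addr0 mulN1r addNr.
Qed.

Lemma multilinear_sum Phi s1 s2 (I : Type) (r : seq I) (a : I -> R) (x : I -> V) :
  multilinear Phi ->
  Phi (s1 ++ (\sum_(i <- r) a i *: x i) :: s2) =
  \sum_(i <- r) a i * Phi (s1 ++ x i :: s2).
Proof.
move=> lin; elim: r => [|i r IHr]; first by rewrite !big_nil multilinear0.
by rewrite !big_cons lin IHr.
Qed.

Lemma alternating_swap Phi s1 x y s2 : multilinear Phi -> alternating Phi ->
  Phi (s1 ++ x :: y :: s2) = - Phi (s1 ++ y :: x :: s2).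
Proof.
move=> lin alt; apply/eqP; rewrite -addr_eq0; apply/eqP.
have := alt s1 (x + y) s2.
have lin2 z : Phi (s1 ++ z :: (x + y) :: s2) =
    Phi (s1 ++ z :: x :: s2) + Phi (s1 ++ z :: y :: s2).
  by rewrite -!(cat_rcons z) multilinearD.
by rewrite multilinearD // !lin2 !alt add0r addr0.
Qed.

Lemma alternating_move Phi s1 s2 x s3 : multilinear Phi -> alternating Phi ->
  Phi (s1 ++ x :: s2 ++ s3) = (-1) ^+ size s2 * Phi (s1 ++ s2 ++ x :: s3).
Proof.
move=> lin alt; elim: s2 s1 => [|y s2 IHs] s1; first by rewrite mul1r.
by rewrite /= alternating_swap // -cat_rcons IHs cat_rcons exprS -mulrA mulN1r.
Qed.

Lemma alternating_repeat Phi s1 s2 x s3 : multilinear Phi -> alternating Phi ->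
  Phi (s1 ++ x :: s2 ++ x :: s3) = 0.
Proof.
move=> lin alt; rewrite alternating_move //.
by rewrite [s1 ++ _]catA alt mulr0.
Qed.

Lemma alternating_mem Phi s1 x s2 : multilinear Phi -> alternating Phi ->
  x \in s2 -> Phi (s1 ++ x :: s2) = 0.
Proof.
by move=> lin alt /splitPr[s3 s4]; apply: alternating_repeat.
Qed.

(** The sign of the unshuffling permutation stays unspecified because the final Pfaffian is only
    needed up to sign. *)
Lemma alternating_pairs Phi (l : seq (V * V)) s1 :
  multilinear Phi -> alternating Phi ->
  exists b : bool, Phi (s1 ++ flatten [seq [:: p.1; p.2] | p <- l]) =
    (-1) ^+ b * Phi (s1 ++ unzip1 l ++ unzip2 l).
Proof.
move=> lin alt; elim: l s1 => [|[x y] l IHl] s1; first by exists false; rewrite mul1r.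
have [b Hb] := IHl (s1 ++ [:: x; y]); exists (b (+) odd (size (unzip1 l))).
move: Hb; rewrite /= -!catA /= => ->.
rewrite -cat_rcons alternating_move // cat_rcons mulrA; congr (_ * _).
by rewrite signr_addb signr_odd.
Qed.

(** * Pfaffians *)

(** The interior product of [Phi] with the functional [g]: the alternating sum over all ways to
    remove one entry [y] at the cost [g y]. [contract_ord] is the closed form; the recursion suits
    inductions along the list. *)
Fixpoint contract g Phi s : R :=
  if s is y :: s' then g y * Phi s' - contract g (fun t => Phi (y :: t)) s'
  else 0.

Lemma eq_contract g Phi Psi s :
    (forall t, (size t).+1 = size s -> Phi t = Psi t) ->
  contract g Phi s = contract g Psi s.
Proof.
elim: s Phi Psi => //= y s IHs Phi Psi eqP.
rewrite eqP //; congr (_ - _); apply: IHs => t sz_t.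
by apply: eqP; rewrite /= sz_t.
Qed.

Lemma contract0 g s : contract g (fun=> 0) s = 0.
Proof. by elim: s => //= y s ->; rewrite mulr0 subr0. Qed.

Lemma contract_lin g Phi Psi a s :
  contract g (fun t => a * Phi t + Psi t) s =
  a * contract g Phi s + contract g Psi s.
Proof.
elim: s Phi Psi => /= [|y s IHs] Phi Psi; first by rewrite mulr0 addr0.
by rewrite IHs; ring.
Qed.

(** Two entries can be removed in either order, and the two orders carry opposite signs. *)
Lemma contract_twice g Phi s : contract g (contract g Phi) s = 0.
Proof.
elim: s Phi => //= y s IHs Phi.
have -> : contract g (fun t => g y * Phi t - contract g (fun u => Phi (y :: u)) t) s
  = g y * contract g Phi s - contract g (contract g (fun u => Phi (y :: u))) s.
  transitivity (contract g (fun t => g y * Phi t +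
      (-1 * contract g (fun u => Phi (y :: u)) t + 0)) s).
    by apply: eq_contract => t _; rewrite addr0 mulN1r.
  by rewrite contract_lin contract_lin contract0 addr0 mulN1r.
by rewrite IHs subr0 subrr.
Qed.

Lemma contract_alternating g Phi : alternating Phi -> alternating (contract g Phi).
Proof.
move=> alt s1; elim: s1 Phi alt => /= [|y s1 IHs] Phi alt x s2.
  have -> : contract g (fun t => Phi (x :: x :: t)) s2 = 0.
    by rewrite -[RHS](contract0 g s2); apply: eq_contract => t _; apply: (alt [::]).
  by rewrite subr0 subrr.
rewrite alt mulr0 IHs ?subr0 // => t1 z t2; exact: (alt (y :: t1)).
Qed.

Lemma contract_multilinear g Phi :
    (forall a x y, g (a *: x + y) = a * g x + g y) ->
  multilinear Phi -> multilinear (contract g Phi).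
Proof.
move=> gl lin s1; elim: s1 Phi lin => /= [|z s1 IHs] Phi lin a x y s2.
  rewrite gl; have -> : contract g (fun t => Phi (a *: x + y :: t)) s2 =
     contract g (fun t => a * Phi (x :: t) + Phi (y :: t)) s2.
    by apply: eq_contract => t _; apply: (lin [::]).
  by rewrite contract_lin; ring.
rewrite lin IHs; last by move=> t1 b u v t2; apply: (lin (z :: t1)).
by ring.
Qed.

Lemma contract_cat0 g Phi s1 s2 : {in s1, forall x, g x = 0} ->
  contract g Phi (s1 ++ s2) =
  (-1) ^+ size s1 * contract g (fun t => Phi (s1 ++ t)) s2.
Proof.
elim: s1 Phi => [|x s1 IHs] Phi g0 /=; first by rewrite mul1r.
rewrite g0 ?mem_head // mul0r sub0r IHs ?exprS ?mulN1r ?mulNr //.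
by move=> y ys; rewrite g0 // inE ys orbT.
Qed.

Lemma contract_ord g Phi s : contract g Phi s =
  \sum_(j < size s) (-1) ^+ j * g s`_j * Phi (take j s ++ drop j.+1 s).
Proof.
elim: s Phi => [|y s IHs] Phi; first by rewrite big_ord0.
rewrite /= big_ord_recl /= drop0 mul1r IHs -sumrN; congr (_ + _).
by apply: eq_bigr => j _; rewrite exprS -!mulrA mulN1r.
Qed.

Section Pfaffian.
Variable beta : V -> V -> R.
Hypotheses (betaxx : forall x, beta x x = 0)
  (beta_linl : forall z a x y, beta (a *: x + y) z = a * beta x z + beta y z)
  (beta_linr : forall z a x y, beta z (a *: x + y) = a * beta z x + beta z y).

(* Expansion along the first row, recursively; [n] only bounds the depth. *)
Fixpoint pf_fuel n s : R :=
  if s is x :: s' then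
    if n is n'.+1 then contract (beta x) (pf_fuel n') s' else 0
  else 1.

Definition pf s := pf_fuel (size s) s.

Lemma pf_fuelS n s : (size s <= n)%N -> pf_fuel n.+1 s = pf_fuel n s.
Proof.
elim: n s => [|n IHn] [|x s] // le_sn.
by apply: eq_contract => t sz_t; apply: IHn; move: le_sn => /=; lia.
Qed.

Lemma pf_fuelE n s : (size s <= n)%N -> pf_fuel n s = pf s.
Proof.
elim: n => [|n IHn]; first by case: s.
by rewrite leq_eqVlt => /predU1P[<- // | ?]; rewrite pf_fuelS ?IHn.
Qed.

Lemma pf_cons x s : pf (x :: s) = contract (beta x) pf s.
Proof.
apply: eq_contract => t sz_t; have le_ts : (size t <= size s)%N by rewrite -sz_t.
exact: pf_fuelE le_ts.
Qed.

Lemma pf_odd s : odd (size s) -> pf s = 0.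
Proof.
have [n le_sn] := ubnP (size s); elim: n s le_sn => // n IHn [|x s] //= lt_sn odd_s.
rewrite pf_cons -(contract0 (beta x) s); apply: eq_contract => t sz_t.
by apply: IHn; move: odd_s lt_sn => /=; lia.
Qed.

(** With the equal pair in front, the term [beta x x] vanishes and the rest contracts twice by the
    same functional [beta x]. A pair further back survives contraction by [contract_alternating]. *)
Lemma pf_fuel_alternating n : alternating (pf_fuel n).
Proof.
elim: n => [|n IHn] [|y s1] x s2 //=; last exact: contract_alternating.
rewrite betaxx mul0r sub0r; case: n {IHn} => [|n] /=.
  by rewrite (contract0 (beta x) s2) oppr0.
by rewrite (contract_twice (beta x) (pf_fuel n) s2) oppr0.
Qed.

Lemma pf_alternating : alternating pf.
Proof. by move=> s1 x s2; apply: pf_fuel_alternating. Qed.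

Lemma pf_fuel_multilinear n : multilinear (pf_fuel n).
Proof.
elim: n => [|n IHn] [|z s1] a x y s2 //=; rewrite ?mulr0 ?addr0 //.
  elim: s2 (pf_fuel n) => [|u s2 IHs] Phi /=; first by rewrite mulr0 addr0.
  by rewrite IHs beta_linl; ring.
by apply: contract_multilinear => // b u v; apply: beta_linr.
Qed.

Lemma pf_multilinear : multilinear pf.
Proof.
by move=> s1 a x y s2; rewrite /pf !size_cat /=; apply: pf_fuel_multilinear.
Qed.

Lemma nth_codom_ord n (q : 'I_n -> V) (i : 'I_n) : (codom q)`_i = q i.
Proof. by rewrite codomE (nth_map i) ?size_enum_ord // nth_ord_enum. Qed.

Lemma codom_lift_take n (q : 'I_n.+1 -> V) (j : 'I_n.+1) :
  codom (fun i => q (lift j i)) = take j (codom q) ++ drop j.+1 (codom q).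
Proof.
have sz : size (take j (codom q)) = j by rewrite size_takel // size_codom card_ord ltnW.
apply: (@eq_from_nth _ 0).
  rewrite size_cat sz size_drop !size_codom !card_ord; have := ltn_ord j; lia.
move=> i; rewrite size_codom card_ord => lt_in.
rewrite (nth_codom_ord (fun i => q (lift j i)) (Ordinal lt_in)) nth_cat sz.
rewrite -nth_codom_ord.
rewrite /= /bump; case: ltnP => [lt_ij|le_ji].
  by rewrite nth_take // leqNgt lt_ij.
by rewrite nth_drop; congr (nth _ _ _); lia.
Qed.

(** Expansion along the first [p] skips the remaining [n] vectors [p], which costs [(-1) ^+ n], and
    then runs through the [q] exactly like a determinant expanded along its first row. The signs
    accumulate to the binomial exponent. *)
Lemma pf_isotropic n (p q : 'I_n -> V) :
    (forall i j, beta (p i) (p j) = 0) -> (forall i j, beta (q i) (q j) = 0) ->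
  pf (codom p ++ codom q) =
    (-1) ^+ 'C(n, 2) * \det (\matrix_(i, j) beta (p i) (q j)).
Proof.
elim: n p q => [|n IHn] p q pp0 qq0.
  by rewrite det_mx00 !codomE !enum_ord0 mulr1.
have -> : codom p = p ord0 :: codom (fun i => p (lift ord0 i)).
  by rewrite !codomE enum_ordSl /= -map_comp.
rewrite /= pf_cons contract_cat0; last by move=> _ /codomP[i ->].
rewrite size_codom card_ord contract_ord size_codom card_ord.
rewrite (expand_det_row _ ord0) binS bin1 exprD !mulr_sumr; apply: eq_bigr => j _.
rewrite -codom_lift_take IHn // (nth_codom_ord q j) mxE.
rewrite /cofactor add0n.
have -> : row' ord0 (col' j (\matrix_(i, k) beta (p i) (q k))) =
    \matrix_(i, k) beta (p (lift ord0 i)) (q (lift j k)).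
  by apply/matrixP=> i k; rewrite !mxE.
by ring.
Qed.

End Pfaffian.
End Alternating.

(** * The skew form and the ring vectors *)

Section Triangular.
Variables (R : comNzRingType) (Phi : seq {poly R} -> R).
Hypotheses (lin : multilinear Phi) (alt : alternating Phi).

(** The list starts with the highest degree. Once the later vectors are monomials, every lower term
    of the current vector repeats one of them and is killed, so only the diagonal coefficient
    remains. *)
Lemma triangular_change (w : nat -> {poly R}) N s1 :
    (forall i, (i < N)%N -> (size (w i) <= i.+1)%N) ->
  Phi (s1 ++ [seq w i | i <- rev (iota 0 N)]) =
  \prod_(i < N) (w i)`_i * Phi (s1 ++ [seq 'X^i | i <- rev (iota 0 N)]).
Proof.
elim: N s1 => [|N IHN] s1 sz_w; first by rewrite big_ord0 mul1r.
rewrite -addn1 iotaD add0n rev_cat /= -cat_rcons IHN; last first.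
  by move=> i lt_iN; rewrite sz_w // ltnW // ltnS.
rewrite cat_rcons addn1 big_ord_recr /= -mulrA; congr (_ * _).
have def_w : w N = \sum_(i < N.+1) (w N)`_i *: 'X^i.
  rewrite -poly_def; apply/polyP => k; rewrite coef_poly.
  case: ifP => // /negbT; rewrite -leqNgt => le_Nk.
  by rewrite nth_default // (leq_trans (sz_w N _)).
rewrite {1}def_w multilinear_sum // big_ord_recr /= big1 ?add0r // => i _.
rewrite alternating_mem ?mulr0 //.
by apply/mapP; exists (val i); rewrite // mem_rev mem_iota ltn_ord.
Qed.
End Triangular.

Section Form.
Variables (R : comNzRingType) (N : nat).
Implicit Types f g : {poly R}.

Definition flip f := f \Po (1 - 'X).

Definition dotp f g : R := \sum_(i < N) f`_i * g`_i.

Definition skewform f g := dotp (flip f) g - dotp f (flip g).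

Lemma dotp_linl g a f1 f2 : dotp (a *: f1 + f2) g = a * dotp f1 g + dotp f2 g.
Proof.
rewrite /dotp mulr_sumr -big_split; apply: eq_bigr => i _.
by rewrite coefD coefZ mulrDl mulrA.
Qed.

Lemma dotpC f g : dotp f g = dotp g f.
Proof. by apply: eq_bigr => i _; rewrite mulrC. Qed.

Lemma flip_lin a f g : flip (a *: f + g) = a *: flip f + flip g.
Proof. by rewrite /flip comp_polyD comp_polyZ. Qed.

Lemma skewform_alt f : skewform f f = 0.
Proof. by rewrite /skewform dotpC subrr. Qed.

Lemma skewform_linl g a f1 f2 : skewform (a *: f1 + f2) g = a * skewform f1 g + skewform f2 g.
Proof. by rewrite /skewform flip_lin !dotp_linl; ring. Qed.

Lemma skewform_linr g a f1 f2 : skewform g (a *: f1 + f2) = a * skewform g f1 + skewform g f2.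
Proof.
rewrite /skewform flip_lin ![dotp _ (_ + _)]dotpC !dotp_linl.
by rewrite ![dotp _ g]dotpC ![dotp _ (flip g)]dotpC; ring.
Qed.

(* The functional reading position [p] of ring [h], in coordinates in which the skew
   form does not depend on [h]. *)
Definition rowvec h p : {poly R} := \poly_(k < h) ('C(h.-1 - k, p))%:R.

(** Pascal's rule, read as the two moves of a particle towards the next inner ring: one step down or
    no step. *)
Lemma rowvecS h p : rowvec h.+1 p.+1 = rowvec h p + rowvec h p.+1.
Proof.
apply/polyP => k; rewrite coefD !coef_poly ltnS /=.
case: (ltngtP k h) => [lt_kh|//|->]; last by rewrite subnn addr0.
  by rewrite -natrD addnC -binS -subSn 1?subn1 1?prednK //; lia.
by rewrite addr0.
Qed.

Lemma rowvec0 h : rowvec h.+1 0 = rowvec h 0 + 'X^h.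
Proof.
apply/polyP => k; rewrite coefD !coef_poly coefXn ltnS /= !bin0.
by case: (ltngtP k h) => _; rewrite ?addr0 ?add0r.
Qed.

(** Ring [h] has the positions [0] to [h - 1], so a particle that keeps position [h] on the way in
    contributes zero. *)
Lemma rowvec_diag h : rowvec h h = 0.
Proof.
apply/polyP => k; rewrite coef_poly coef0; case: ifP => // lt_kh.
by rewrite bin_small //; lia.
Qed.

Lemma size_rowvec h p : (size (rowvec h.+1 p) <= h.+1 - p)%N.
Proof.
apply/leq_sizeP => k le_k; rewrite coef_poly; case: ifP => //= lt_kh.
by rewrite bin_small //; lia.
Qed.

Lemma coef_1subX n k : ((1 - 'X) ^+ n : {poly R})`_k = (-1) ^+ k * ('C(n, k))%:R.
Proof.
have -> : (1 - 'X) ^+ n = \poly_(i < n.+1) ((-1) ^+ i * ('C(n, i))%:R) :> {poly R}.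
  rewrite exprBn poly_def; apply: eq_bigr => i _.
  rewrite expr1n mulr1 -scalerA -signr_odd -[in RHS]signr_odd mulr_sign scaler_sign.
  by rewrite scaler_nat; case: odd; rewrite ?mulNrn.
by rewrite coef_poly ltnS; case: leqP => // lt_nk; rewrite bin_small ?mulr0.
Qed.

Lemma bin_trinomial n i j : ('C(n, i) * 'C(n - i, j) = 'C(n, j) * 'C(n - j, i))%N.
Proof.
case: (leqP (i + j) n) => [le_ijn|lt_n]; last first.
  suff z a b : (n < a + b)%N -> ('C(n, a) * 'C(n - a, b) = 0)%N by rewrite !z // addnC.
  case: (leqP a n) => [le_an|lt_na] lt_nab; last by rewrite bin_small.
  by rewrite ['C(n - a, b)]bin_small ?muln0 //; lia.
have fn0 m : (0 < m`!)%N by apply: fact_gt0.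
have e1 := bin_fact (ltac:(lia) : (i <= n)%N).
have e2 := bin_fact (ltac:(lia) : (j <= n - i)%N).
have e3 := bin_fact (ltac:(lia) : (j <= n)%N).
have e4 := bin_fact (ltac:(lia) : (i <= n - j)%N).
rewrite (subnAC n j i) in e4.
apply/eqP; rewrite -(eqn_pmul2r (fn0 (n - i - j)%N)) -(eqn_pmul2r (fn0 i)).
rewrite -(eqn_pmul2r (fn0 j)).
apply/eqP; transitivity n`!.
  by rewrite -e1 -e2; ring.
by rewrite -e3 -e4; ring.
Qed.

Lemma size_flip f : (size (flip f) <= size f)%N.
Proof.
rewrite /flip comp_polyE; apply: leq_trans (size_sum _ _ _) _.
apply/bigmax_leqP => i _; apply: leq_trans (size_scale_leq _ _) _.
apply/leq_sizeP => k le_k; rewrite coef_1subX bin_small ?mulr0 //.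
exact: leq_trans (ltn_ord i) le_k.
Qed.

(** The second pairing vanishes because flipping preserves the degree bound [h - q < h]. The first
    is the alternating sum of [C(h, i) C(h - i, q) = C(h, q) C(h - q, i)] over [i], that is,
    [C(h, q)] times [(1 - X)^(h - q)] at [X = 1]. *)
Lemma skewform_Xn h q : (h < N)%N -> (0 < q <= h)%N ->
  skewform 'X^h (rowvec h.+1 q) = (q == h)%:R.
Proof.
move=> lt_hN /andP[q_gt0 le_qh]; rewrite /skewform [X in _ - X]big1 ?subr0; last first.
  move=> i _; rewrite coefXn; case: eqP => [->|_]; last by rewrite mul0r.
  rewrite nth_default ?mulr0 //; apply: leq_trans (size_flip _) _.
  by apply: leq_trans (size_rowvec _ _) _; lia.
rewrite /dotp /flip comp_Xn_poly.
transitivity (\sum_(i < N) ('C(h, q))%:R * ((1 - 'X) ^+ (h - q) : {poly R})`_i).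
  apply: eq_bigr => i _; rewrite !coef_1subX coef_poly /= ltnS.
  case: leqP => [le_ih|lt_hi]; last first.
    by rewrite ['C(h - q, i)]bin_small ?mulr0 //; lia.
  by rewrite mulrCA -!mulrA -!natrM bin_trinomial.
rewrite -mulr_sumr.
have sz : (size ((1 - 'X) ^+ (h - q) : {poly R}) <= N)%N.
  by apply/leq_sizeP => k le_k; rewrite coef_1subX bin_small ?mulr0 //; lia.
have -> : \sum_(i < N) ((1 - 'X) ^+ (h - q))`_i = ((1 - 'X) ^+ (h - q)).[1] :> R.
  by rewrite (horner_coef_wide _ sz); apply: eq_bigr => i _; rewrite expr1n mulr1.
rewrite !hornerE subrr; case: (eqVneq q h) => [->|ne_qh].
  by rewrite subnn expr0 binn mulr1.
by rewrite expr0n subn_eq0 leqNgt ltn_neqAle ne_qh le_qh /= mulr0.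
Qed.

End Form.

(** * Counting ring by ring *)

(* Directions: 0 is the edge away from the apex, 1 and 2 are the edges towards the
   first and the second side of the sextant; [c] marks the nonzero entries. *)
Fixpoint rows (c : bitseq) : seq (seq nat) :=
  if c is b :: c' then
    if b then [seq 1%N :: r | r <- rows c'] ++ [seq 2 :: r | r <- rows c']
    else [seq 0%N :: r | r <- rows c']
  else [:: [::]].

(* The downward triangle between consecutive upward ones is not covered twice. *)
Definition compat (a b : nat) := ~~ ((a == 2) && (b == 1%N)).

(* A lozenge leaves the row across the seam on one side iff it enters on the other. *)
Definition glued (r : seq nat) := (head 0%N r == 1%N) == (last 0%N r == 2).

(* The particles on the next inner ring. *)
Definition inner (r : seq nat) : bitseq :=
  if r is d :: r' then pairmap (fun a b => (a == 2) || (b == 1%N)) d r' else [::].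

(** Fillings of a sextant with [h] rings, listed from the outermost ring inwards; [c] holds the
    particles of the outermost ring. *)
Fixpoint stacks (h : nat) (c : bitseq) : seq (seq (seq nat)) :=
  if h is h'.+1 then
    flatten [seq [seq r :: st | st <- stacks h' (inner r)]
            | r <- rows c & sorted compat r && glued r]
  else [:: [::]].

Lemma rows_mapE c r : r \in rows c ->
  [seq d != 0%N | d <- r] = c /\ all (fun d => d < 3)%N r.
Proof.
elim: c r => [|[] c IHc] r /=; first by rewrite inE => /eqP->.
  by rewrite mem_cat => /orP[] /mapP[r' /IHc[rc r3] ->]; rewrite /= rc.
by move=> /mapP[r' /IHc[rc r3] ->]; rewrite /= rc.
Qed.

Lemma mem_rows r : all (fun d => d < 3)%N r -> r \in rows [seq d != 0%N | d <- r].
Proof.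
elim: r => [|[|[|[|//]]] r IHr] //= /IHr r_in; rewrite ?mem_cat map_f ?orbT //.
Qed.

Lemma size_rows c r : r \in rows c -> size r = size c.
Proof. by move=> /rows_mapE[<- _]; rewrite size_map. Qed.

Lemma size_inner r : size (inner r) = (size r).-1.
Proof. by case: r => //= d r; rewrite size_pairmap. Qed.

Lemma uniq_rows c : uniq (rows c).
Proof.
elim: c => [|[] c IHc] //=; last by rewrite map_inj_uniq // => ? ? [].
rewrite cat_uniq !map_inj_uniq ?IHc; try by move=> ? ? [].
by rewrite andbT /=; apply/hasPn => _ /mapP[r _ ->]; apply/negP => /mapP[].
Qed.

Lemma uniq_stacks h c : uniq (stacks h c).
Proof.
elim: h c => //= h IHh c; apply: allpairs_uniq_dep.
- by rewrite filter_uniq ?uniq_rows.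
- by move=> r _; apply: IHh.
- by move=> [r1 s1] [r2 s2] _ _ [-> ->].
Qed.

Section RowSums.
Variables (R : comNzRingType) (F : seq nat -> R).

Lemma big_rows_rcons c b : \sum_(r <- rows (rcons c b)) F r =
  \sum_(r <- rows c) (if b then F (rcons r 1%N) + F (rcons r 2) else F (rcons r 0%N)).
Proof.
elim: c F => [|[] c IHc] G /=.
- by case: b; rewrite /= !big_cons !big_nil /= ?addr0.
- by rewrite !big_cat !big_map !IHc.
- by rewrite !big_map IHc.
Qed.

End RowSums.

Section RowExpansion.
Variables (R : comNzRingType) (Phi : seq {poly R} -> R).
Hypotheses (lin : multilinear Phi) (alt : alternating Phi).

Fixpoint select (f : nat -> {poly R}) p (c : bitseq) :=
  if c is b :: c' then
    if b then f p :: select f p.+1 c' else select f p.+1 c'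
  else [::].

Lemma eq_select f g p c : (forall q, (p <= q < p + size c)%N -> f q = g q) ->
  select f p c = select g p c.
Proof.
elim: c p => //= b c IHc p eq_fg.
rewrite (IHc p.+1) ?eq_fg //; first by lia.
by move=> q q_in; apply: eq_fg; lia.
Qed.

Lemma select_rcons f p c b :
  select f p (rcons c b) =
  select f p c ++ (if b then [:: f (p + size c)%N] else [::]).
Proof.
elim: c p => [|[] c IHc] p /=; rewrite ?addn0 //; first by rewrite IHc addSnnS.
by rewrite IHc addSnnS.
Qed.

(** The zero at position 0 suppresses a step below the first position; exits through the seam enter
    separately through the monomial of [rowvec0]. *)
Definition prevvec h p : {poly R} := if p is q.+1 then rowvec R h q else 0.

(** Direction 1 takes the particle at [p] to position [p - 1] of the next ring, direction 2 leaves
    it at [p]. *)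
Fixpoint place h p (r : seq nat) :=
  if r is d :: r' then
    if d == 0%N then place h p.+1 r'
    else (if d == 1%N then prevvec h p else rowvec R h p) :: place h p.+1 r'
  else [::].

Lemma expand_select h p c s1 :
  Phi (s1 ++ select (fun q => prevvec h q + rowvec R h q) p c) =
  \sum_(r <- rows c) Phi (s1 ++ place h p r).
Proof.
elim: c p s1 => [|[] c IHc] p s1 /=; first by rewrite big_seq1.
  rewrite multilinearD // big_cat !big_map /=.
  by congr (_ + _); rewrite -cat_rcons IHc; apply: eq_bigr => r _; rewrite cat_rcons.
by rewrite big_map IHc.
Qed.

(** A collision places the same vector twice in succession and is killed by [alt]; a last particle
    that stays put reads position [h], where the vector is zero. The optional [prevvec h p] belongs
    to a first particle stepping below the positions that [inner] records. *)
Lemma place_inner h p d r s1 : (d < 3)%N -> all (fun e => e < 3)%N r ->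
    (p + size r = h)%N ->
  Phi (s1 ++ place h p (d :: r)) =
  if path compat d r && (last d r != 2) then
    Phi (s1 ++ (if d == 1%N then [:: prevvec h p] else [::]) ++
         select (rowvec R h) p (inner (d :: r)))
  else 0.
Proof.
elim: r p d s1 => [|e r IHr] p d s1 d3 /=.
  move=> _ /eqP; rewrite addn0 => /eqP->.
  case: d d3 => [|[|[|//]]] _ //=.
  by rewrite rowvec_diag multilinear0.
case/andP=> e3 r3 sz; have sz' : (p.+1 + size r = h)%N by lia.
case: d d3 => [|[|[|//]]] _; rewrite /= ?orFb.
- rewrite [LHS](IHr p.+1 e s1) //=; case: ifP => // _.
  by case: eqP.
- rewrite -cat_rcons [LHS](IHr p.+1 e) //= cat_rcons; case: ifP => // _.
  by case: eqP.
rewrite -cat_rcons [LHS](IHr p.+1 e) //= cat_rcons /compat /=.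
case: (eqVneq e 1%N) => [_|_] //=.
by rewrite alt; case: ifP.
Qed.

End RowExpansion.

(** A joint exit through the seam looks to the next ring like two empty ends; [sorted_ends] says the
    same for collisions. *)
Lemma inner_ends w : inner (1%N :: rcons w 2) = inner (0%N :: rcons w 0%N).
Proof.
rewrite /= -!cats1 !pairmap_cat /= orbF; case: w => //= e w.
by rewrite orbF.
Qed.

Lemma sorted_ends w :
  sorted compat (1%N :: rcons w 2) = sorted compat (0%N :: rcons w 0%N).
Proof.
by rewrite /= !rcons_path {2 4}/compat !andbF !andbT; case: w.
Qed.

Section StackCount.
Variables (R : comNzRingType) (N : nat).
Let beta : {poly R} -> {poly R} -> R := skewform N.
Let lin := pf_multilinear (@skewform_linl R N) (@skewform_linr R N).
Let alt := pf_alternating (@skewform_alt R N).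

Let step h q : {poly R} := prevvec R h q + rowvec R h q.

Let F h r := pf beta (select (rowvec R h) 0 (inner r)).

(** These are the rows without exit through the seam: an exit at either end would contribute a zero
    vector, [prevvec] at 0 or [rowvec] on the diagonal. *)
Lemma pf_step h c : size c = h.+1 ->
  pf beta (select (step h) 0 c) =
  \sum_(r <- rows c | sorted compat r && (head 0%N r != 1%N) && (last 0%N r != 2))
    F h r.
Proof.
move=> sz_c; rewrite [LHS](expand_select lin h 0 c [::]) [RHS]big_mkcond.
apply: eq_big_seq => r r_in; have [_ r3] := rows_mapE r_in.
case: r r_in r3 => [|d r]; first by move=> /size_rows; rewrite sz_c.
move=> /size_rows; rewrite sz_c => -[sz_r] /= /andP[d3 r3].
rewrite [LHS](place_inner lin alt (p := 0) [::]) // cat0s andbAC.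
case: (eqVneq d 1%N) => _; last by rewrite andbT.
by rewrite /= andbF (multilinear0 [::] _ lin) if_same.
Qed.

Lemma select_step h c : select (rowvec R h.+1) 1 c = select (step h) 1 c.
Proof. by apply: eq_select => -[|q] //= _; rewrite rowvecS. Qed.

Lemma skewform_select h c : (h < N)%N -> (size c < h)%N ->
  {in select (rowvec R h.+1) 1 c, forall x, beta 'X^h x = 0}.
Proof.
move=> lt_hN lt_ch; suff gen p : (0 < p)%N -> (p + size c <= h)%N ->
  {in select (rowvec R h.+1) p c, forall x, beta 'X^h x = 0} by apply: gen.
elim: c p {lt_ch} => [|b c IHc] p p_gt0 //= le_pch x.
have {}IHc := IHc p.+1 isT (ltac:(lia)) x.
case: b => //; rewrite inE => /predU1P[->|/IHc //].
by rewrite /beta skewform_Xn ?ltn_eqF //; lia.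
Qed.

(* The monomial in [rowvec0] accounts for the joint exit through the seam: by
   [skewform_Xn] it only pairs with the last position of the ring. *)
Lemma pf_row h c : (h < N)%N -> size c = h.+1 ->
  pf beta (select (rowvec R h.+1) 0 c) =
  \sum_(r <- rows c | sorted compat r && glued r) F h r.
Proof.
move=> lt_hN; case: c => [|[] c] // sz_c; last first.
  rewrite [X in pf _ X]/= select_step (pf_step (c := false :: c)) //.
  rewrite /= !big_map; apply: eq_bigl => r.
  by rewrite andbT /glued /=; case: eqP.
have -> : select (rowvec R h.+1) 0 (true :: c) =
    (step h 0 + 'X^h) :: select (step h) 1 c.
  by rewrite /= select_step rowvec0 /step /= add0r.
rewrite [LHS](multilinearD [::] _ _ _ lin) /=.
rewrite [X in X + _](pf_step (c := true :: c)) //.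
(* A glued row uses the seam at neither end or at both: the first kind matches the summand
   [step h 0], the second the monomial ['X^h]. *)
rewrite [RHS](bigID (fun r => (head 0%N r != 1%N) && (last 0%N r != 2))).
congr (_ + _).
  apply: eq_bigl => r; rewrite /glued.
  by move: (sorted _ _) (head _ _ == _) (last _ _ == _) => [] [] [].
rewrite (eq_bigl (fun r =>
  [&& sorted compat r, head 0%N r == 1%N & last 0%N r == 2])); last first.
  by move=> r; rewrite /glued; move: (sorted _ _) (head _ _ == _) (last _ _ == _) => [] [] [].
rewrite pf_cons -select_step.
case/lastP: c sz_c => [|c b] sz_c; first by rewrite /= !big_cons big_nil.
have lt_ch : (size c < h)%N by move: sz_c; rewrite /= size_rcons; lia.
rewrite select_rcons contract_cat0; last exact: skewform_select.
rewrite /= big_cat !big_map /= [X in _ + X]big_pred0 ?addr0; last by move=> r; rewrite andbF.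
rewrite big_mkcond big_rows_rcons.
case: b sz_c => sz_c; last first.
  by rewrite mulr0 big1 // => r _; rewrite last_rcons andbF.
have sz_ch : (size c).+1 = h by move: sz_c => [] <-; rewrite size_rcons.
rewrite [contract _ _ _]/= subr0 add1n sz_ch skewform_Xn ?leqnn ?(leq_trans _ lt_ch) //.
rewrite eqxx mul1r cats0.
transitivity (pf beta (select (rowvec R h.+1) 1 c)).
  case: (boolP (odd (size (select (rowvec R h.+1) 1 c)))) => [/pf_odd->|even_s].
    by rewrite mulr0.
  by rewrite -signr_odd (negbTE even_s) mul1r.
(* With both extreme particles gone, the ring has empty ends and [pf_step] applies to it. *)
have -> : select (rowvec R h.+1) 1 c = select (step h) 0 (false :: rcons c false).
  by rewrite select_step /= select_rcons cats0.
rewrite pf_step /= ?size_rcons ?sz_ch // big_map big_mkcond big_rows_rcons.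
apply: eq_bigr => r _; rewrite !last_rcons /= andbF add0r andbT andbT.
rewrite -[path _ 1%N _]/(sorted compat (1%N :: rcons r 2)) sorted_ends.
by rewrite /= last_rcons andbT /F inner_ends.
Qed.

Theorem size_stacks h c : (h <= N)%N -> size c = h ->
  (size (stacks h c))%:R = pf beta (select (rowvec R h) 0 c).
Proof.
elim: h c => [|h IHh] c lt_hN sz_c; first by case: c sz_c.
rewrite pf_row // [stacks _ _]/= size_flatten /shape -map_comp sumnE big_map big_filter.
rewrite natr_sum big_seq_cond [RHS]big_seq_cond; apply: eq_bigr => r.
rewrite /= size_map => /andP[/size_rows sz_r _].
by apply: IHh; [apply: ltnW | rewrite size_inner sz_r sz_c].
Qed.

End StackCount.

(** * Condensation and the Andrews-Burge determinant *)

Section Condensation.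
Variable F : fieldType.

Lemma det_schur m n (A : 'M[F]_m) (B : 'M_(m, n)) (C : 'M_(n, m)) (M : 'M_n) :
  M \in unitmx ->
  \det (block_mx A B C M) = \det M * \det (A - B *m invmx M *m C).
Proof.
move=> uM; have -> : block_mx A B C M =
    block_mx 1%:M (B *m invmx M) 0 1%:M *m block_mx (A - B *m invmx M *m C) 0 C M.
  by rewrite mulmx_block !mul1mx !mul0mx !add0r mulmxKV // subrK.
by rewrite det_mulmx det_ublock det_lblock !det1 !mul1r mulrC.
Qed.

Lemma det_mx2 (A : 'M[F]_2) :
  \det A = A ord0 ord0 * A ord_max ord_max - A ord0 ord_max * A ord_max ord0.
Proof.
rewrite (expand_det_row _ ord0) !big_ord_recl big_ord0 addr0 /cofactor.
rewrite !det_mx11 !mxE /= expr0 expr1 mul1r mulN1r mulrN.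
by congr (_ * _ - _ * _); congr (A _ _); apply: val_inj.
Qed.

Definition leading (f : nat -> nat -> F) n := \det (\matrix_(i < n, j < n) f i j).

(* Both sides are [\det M ^+ 2] times the determinant of the Schur complement. *)
Lemma condensation_block n (A : 'M[F]_2) (B : 'M_(2, n)) (C : 'M_(n, 2)) (M : 'M_n)
    (minor := fun p q => \det (block_mx (A p q)%:M (row p B) (col q C) M)) :
    \det M != 0 ->
  \det (block_mx A B C M) * \det M =
  minor ord0 ord0 * minor ord_max ord_max - minor ord0 ord_max * minor ord_max ord0.
Proof.
move=> nzM; have uM : M \in unitmx by rewrite unitmxE unitfE.
have minorE p q : minor p q = \det M * (A - B *m invmx M *m C) p q.
  rewrite /minor det_schur // det_mx11 !mxE eqxx; congr (_ * (_ - _)).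
  by apply: eq_bigr => k _; rewrite -row_mul !mxE.
by rewrite !minorE det_schur // det_mx2; ring.
Qed.

(** The cyclic permutation that lists the last index first; it brings the outer rows and columns in
    front of the inner block. *)
Definition last_first n (i : 'I_n.+1) : 'I_n.+1 :=
  if i == ord0 then ord_max else inord i.-1.

Lemma last_firstE n (i : 'I_n.+1) :
  last_first i = (if i == 0 :> nat then n else i.-1) :> nat.
Proof.
rewrite /last_first -val_eqE /=; case: eqP => //= ?; rewrite inordK //.
by have := ltn_ord i; lia.
Qed.

Lemma last_first_inj n : injective (@last_first n).
Proof.
move=> i j /(congr1 val); rewrite /= !last_firstE => eq_ij; apply: val_inj.
by move: eq_ij (ltn_ord i) (ltn_ord j); case: eqP; case: eqP => /=; lia.
Qed.

Lemma det_perm_rows n (s : 'S_n) (g : 'I_n -> 'I_n -> F) :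
  \det (\matrix_(i, j) g (s i) j) = (-1) ^+ s * \det (\matrix_(i, j) g i j).
Proof.
rewrite -det_perm -det_mulmx -row_permE; congr (\det _).
by apply/matrixP => i j; rewrite !mxE.
Qed.

Lemma det_perm_cols n (s : 'S_n) (g : 'I_n -> 'I_n -> F) :
  \det (\matrix_(i, j) g i (s j)) = (-1) ^+ s * \det (\matrix_(i, j) g i j).
Proof.
rewrite -[LHS]det_tr -[X in _ = _ * X]det_tr.
have trE h : (\matrix_(i, j) h i j)^T = \matrix_(i, j) h j i :> 'M[F]_n.
  by apply/matrixP => i j; rewrite !mxE.
by rewrite !trE (det_perm_rows s (fun i j => g j i)).
Qed.

(** The Desnanot-Jacobi identity. After reordering, the four corners form the block [A] of
    [condensation_block]; in each product the reordering sign occurs an even number of times. *)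
Lemma condensation (f : nat -> nat -> F) n :
    leading (fun i j => f i.+1 j.+1) n != 0 ->
  leading f n.+2 * leading (fun i j => f i.+1 j.+1) n =
  leading f n.+1 * leading (fun i j => f i.+1 j.+1) n.+1 -
  leading (fun i j => f i j.+1) n.+1 * leading (fun i j => f i.+1 j) n.+1.
Proof.
move=> nzM; pose s := perm (@last_first_inj n).
pose t := lift_perm ord0 ord0 s.
have sE (i : 'I_n.+1) : s i = (if i == 0 :> nat then n else i.-1) :> nat.
  by rewrite permE last_firstE.
pose c (p : 'I_2) := (p * n.+1)%N.
(* [u p] lists one outer index, 0 or [n.+1], followed by the inner indices from 1 to [n]. *)
pose u p (i : 'I_n.+1) := if i == 0 :> nat then c p else i.
pose A : 'M[F]_2 := \matrix_(p, q) f (c p) (c q).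
pose B : 'M[F]_(2, n) := \matrix_(p, j) f (c p) j.+1.
pose C : 'M[F]_(n, 2) := \matrix_(i, q) f i.+1 (c q).
have minorE p q :
    block_mx (A p q)%:M (row p B) (col q C) (\matrix_(i < n, j < n) f i.+1 j.+1) =
    \matrix_(i < n.+1, j < n.+1) f (u p i) (u q j).
  apply/matrixP => i j; rewrite -[i]splitK -[j]splitK.
  by case: (split i) => i'; case: (split j) => j';
     rewrite ?block_mxEul ?block_mxEur ?block_mxEdl ?block_mxEdr !mxE /u /= ?ord1 ?eqxx.
have u0 (i : 'I_n.+1) : u ord0 i = i by rewrite /u /c mul0n; case: eqP => [->|].
have u1 (i : 'I_n.+1) : u ord_max i = (s i).+1.
  by rewrite /u /c mul1n sE; case: eqP => //; lia.
have bigE : block_mx A B C (\matrix_(i < n, j < n) f i.+1 j.+1) =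
    \matrix_(i < n.+2, j < n.+2) f (t i) (t j).
  have tE (i : 'I_n.+2) :
      t i = (if i == 0 :> nat then 0 else if i == 1%N :> nat then n.+1 else i.-1)%N :> nat.
    rewrite /t; case: (unliftP ord0 i) => [j ->|->]; last by rewrite lift_perm_id.
    rewrite lift_perm_lift !lift0 sE /=; case: eqP => [->|] //=.
    by rewrite eqSS; case: eqP => //; lia.
  have tl (p : 'I_2) : t (lshift n p) = c p :> nat.
    by rewrite tE /c; case: p => [[|[|]]] //= _; rewrite mul1n.
  have tr (k : 'I_n) : t (rshift 2 k) = k.+1 :> nat by rewrite tE.
  apply/matrixP => i j; rewrite -[i]splitK -[j]splitK.
  by case: (split i) => i'; case: (split j) => j';
     rewrite ?block_mxEul ?block_mxEur ?block_mxEdl ?block_mxEdr !mxE ?tl ?tr.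
have uE p q (a b : 'I_n.+1 -> nat) : u p =1 a -> u q =1 b ->
    \matrix_(i, j) f (u p i) (u q j) = \matrix_(i, j) f (a i) (b j).
  by move=> ua ub; apply/matrixP => i j; rewrite !mxE ua ub.
have := condensation_block A B C nzM.
rewrite !minorE bigE /leading.
rewrite (det_perm_rows t (fun i j => f i (t j))) (det_perm_cols t (fun i j => f i j)).
rewrite mulrA -expr2 sqrr_sign mul1r => ->.
rewrite (uE _ _ _ _ u0 u0) (uE _ _ _ _ u0 u1) (uE _ _ _ _ u1 u0) (uE _ _ _ _ u1 u1).
rewrite (det_perm_rows s (fun i j => f i.+1 (s j).+1)).
rewrite (det_perm_cols s (fun i j => f i.+1 j.+1)).
rewrite (det_perm_rows s (fun i j => f i.+1 j)) (det_perm_cols s (fun i j => f i j.+1)).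
by rewrite mulrACA -expr2 mulrA -expr2 !sqrr_sign !mul1r.
Qed.

End Condensation.

Definition fct (m : nat) : rat := m`!%:R.

Lemma fctS m : fct m.+1 = m.+1%:R * fct m.
Proof. by rewrite /fct factS natrM. Qed.

Lemma fct_neq0 m : fct m != 0.
Proof. by rewrite pnatr_eq0 -lt0n fact_gt0. Qed.

(* The test makes reciprocal factorials of negative numbers vanish; the numerator is
   the intended one only if [0 < x + y]. *)
Definition ab_entry x y (i j : nat) : rat :=
  if (j <= x + 2 * i)%N && (i <= y + 2 * j)%N then
    fct (x + y + i + j).-1 / (fct (x + 2 * i - j) * fct (y + 2 * j - i))
  else 0.

(** The quotients in the middle are the rising factorials with [i] factors starting at [2x + y + 2i]
    and at [x + 2y + 2i]. *)
Definition ab_factor x y i : rat :=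
  fct i * fct (x + y + i).-1 *
  (fct (2 * x + y + 3 * i).-1 / fct (2 * x + y + 2 * i).-1) *
  (fct (x + 2 * y + 3 * i).-1 / fct (x + 2 * y + 2 * i).-1) /
  (fct (x + 2 * i) * fct (y + 2 * i)).

Definition ab_prod x y n : rat := \prod_(i < n) ab_factor x y i.

Lemma ab_factor_neq0 x y i : ab_factor x y i != 0.
Proof. by rewrite !(mulf_neq0, invr_neq0, fct_neq0). Qed.

Lemma ab_prod_neq0 x y n : ab_prod x y n != 0.
Proof. by apply/prodf_neq0 => i _; apply: ab_factor_neq0. Qed.

Lemma ab_factor_shift x y m : (0 < x + y)%N ->
  ab_factor x y m.+1 * ((x + y + m).+1%:R * (x + 2 * m).+2%:R * (y + 2 * m).+2%:R) =
  ab_factor x.+1 y.+1 m *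
    (m.+1%:R * (2 * x + y + 2 * m).+2%:R * (x + 2 * y + 2 * m).+2%:R).
Proof.
move=> xy_gt0; rewrite /ab_factor.
have [s sE] : exists s, (x + y = s.+1)%N by exists (x + y).-1; lia.
have -> : (x + y + m.+1).-1 = (x + y + m)%N by lia.
have -> : (x.+1 + y.+1 + m).-1 = (x + y + m).+1 by lia.
have -> : (2 * x + y + 3 * m.+1).-1 = (2 * x + y + 3 * m).+2 by lia.
have -> : (2 * x + y + 2 * m.+1).-1 = (2 * x + y + 2 * m).+1 by lia.
have -> : (x + 2 * y + 3 * m.+1).-1 = (x + 2 * y + 3 * m).+2 by lia.
have -> : (x + 2 * y + 2 * m.+1).-1 = (x + 2 * y + 2 * m).+1 by lia.
have -> : (2 * x.+1 + y.+1 + 3 * m).-1 = (2 * x + y + 3 * m).+2 by lia.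
have -> : (2 * x.+1 + y.+1 + 2 * m).-1 = (2 * x + y + 2 * m).+2 by lia.
have -> : (x.+1 + 2 * y.+1 + 3 * m).-1 = (x + 2 * y + 3 * m).+2 by lia.
have -> : (x.+1 + 2 * y.+1 + 2 * m).-1 = (x + 2 * y + 2 * m).+2 by lia.
have -> : (x + 2 * m.+1 = (x + 2 * m).+2)%N by lia.
have -> : (y + 2 * m.+1 = (y + 2 * m).+2)%N by lia.
rewrite !addSn (fctS m) (fctS (x + y + m)) (fctS (x + 2 * m).+1) (fctS (y + 2 * m).+1).
rewrite (fctS (2 * x + y + 2 * m).+1) (fctS (x + 2 * y + 2 * m).+1).
have x0 := ler0n rat x; have y0 := ler0n rat y; have m0 := ler0n rat m.
field; do ?[apply/andP; split]; rewrite ?fct_neq0 //; apply: lt0r_neq0; lra.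
Qed.

(** These are the two products of minors in the condensation at [(x + 1, y + 1)]. Their ratio
    telescopes in [m]: the linear factors at [m + 1] replace those at [m]. *)
Lemma ab_prod_shift x y m :
  ab_prod (x + 3) y m * ab_prod x (y + 3) m *
    ((x + y + 2 + m)%:R * (x + 1 + 2 * m)%:R * (y + 1 + 2 * m)%:R) =
  ab_prod x.+1 y.+1 m * ab_prod x.+2 y.+2 m *
    ((x + y + 2)%:R * (x + 1)%:R * (y + 1)%:R).
Proof.
elim: m => [|m IHm]; first by rewrite /ab_prod !big_ord0 !muln0 !addn0.
rewrite /ab_prod !big_ord_recr -!/(ab_prod _ _ _) /=.
have step : ab_factor (x + 3) y m * ab_factor x (y + 3) m *
    ((x + y + 2 + m.+1)%:R * (x + 1 + 2 * m.+1)%:R * (y + 1 + 2 * m.+1)%:R) =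
  ab_factor x.+1 y.+1 m * ab_factor x.+2 y.+2 m *
    ((x + y + 2 + m)%:R * (x + 1 + 2 * m)%:R * (y + 1 + 2 * m)%:R).
  rewrite /ab_factor.
  have -> : (x + 3 + y + m).-1 = (x + y + m).+2 by lia.
  have -> : (x + (y + 3) + m).-1 = (x + y + m).+2 by lia.
  have -> : (x.+1 + y.+1 + m).-1 = (x + y + m).+1 by lia.
  have -> : (x.+2 + y.+2 + m).-1 = (x + y + m).+3 by lia.
  have eqk k : (2 * (x + 3) + y + k).-1 = (2 * x + y + k).+1.+4 by lia.
  rewrite !{}eqk.
  have eqk k : (2 * x + (y + 3) + k).-1 = (2 * x + y + k).+2 by lia.
  rewrite !{}eqk.
  have eqk k : (2 * x.+1 + y.+1 + k).-1 = (2 * x + y + k).+2 by lia.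
  rewrite !{}eqk.
  have eqk k : (2 * x.+2 + y.+2 + k).-1 = (2 * x + y + k).+1.+4 by lia.
  rewrite !{}eqk.
  have eqk k : (x + 3 + 2 * y + k).-1 = (x + 2 * y + k).+2 by lia.
  rewrite !{}eqk.
  have eqk k : (x + 2 * (y + 3) + k).-1 = (x + 2 * y + k).+1.+4 by lia.
  rewrite !{}eqk.
  have eqk k : (x.+1 + 2 * y.+1 + k).-1 = (x + 2 * y + k).+2 by lia.
  rewrite !{}eqk.
  have eqk k : (x.+2 + 2 * y.+2 + k).-1 = (x + 2 * y + k).+1.+4 by lia.
  rewrite !{}eqk.
  have -> : (x + 3 + 2 * m = (x + 2 * m).+3)%N by lia.
  have -> : (y + 3 + 2 * m = (y + 2 * m).+3)%N by lia.
  have -> : (x + y + 2 + m.+1 = (x + y + m).+3)%N by lia.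
  have -> : (x + y + 2 + m = (x + y + m).+2)%N by lia.
  have -> : (x + 1 + 2 * m.+1 = (x + 2 * m).+3)%N by lia.
  have -> : (y + 1 + 2 * m.+1 = (y + 2 * m).+3)%N by lia.
  have -> : (x + 1 + 2 * m = (x + 2 * m).+1)%N by lia.
  have -> : (y + 1 + 2 * m = (y + 2 * m).+1)%N by lia.
  rewrite !addSn (fctS (x + y + m).+2) (fctS (x + y + m).+1).
  rewrite (fctS (x + 2 * m).+2) (fctS (x + 2 * m).+1) (fctS (x + 2 * m)).
  rewrite (fctS (y + 2 * m).+2) (fctS (y + 2 * m).+1) (fctS (y + 2 * m)).
  have x0 := ler0n rat x; have y0 := ler0n rat y; have m0 := ler0n rat m.
  field; do ?[apply/andP; split]; rewrite ?fct_neq0 //; apply: lt0r_neq0; lra.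
set a := ab_prod _ _ m in IHm *; set b := ab_prod _ _ m in IHm *.
set a' := ab_prod _ _ m in IHm *; set b' := ab_prod _ _ m in IHm *.
transitivity (a * b * (ab_factor (x + 3) y m * ab_factor x (y + 3) m *
    ((x + y + 2 + m.+1)%:R * (x + 1 + 2 * m.+1)%:R * (y + 1 + 2 * m.+1)%:R))).
  by ring.
rewrite step; transitivity (a * b * ((x + y + 2 + m)%:R * (x + 1 + 2 * m)%:R *
   (y + 1 + 2 * m)%:R) * (ab_factor x.+1 y.+1 m * ab_factor x.+2 y.+2 m)); first by ring.
by rewrite IHm; ring.
Qed.

(** For [y = 0] the parameter cannot drop further, but then the first column violates the second
    inequality of [ab_entry] and is zero. [leading_shift_cols] is the mirror image, with the first
    row. *)
Lemma leading_shift_rows x y n : leading (fun i j => ab_entry x y i.+1 j) n =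
  if y is y'.+1 then leading (ab_entry x.+2 y') n else (n == 0%N)%:R.
Proof.
case: y n => [|y] [|n]; rewrite /leading ?det_mx00 //.
  rewrite (expand_det_col _ ord0) big1 // => i _; rewrite mxE /ab_entry.
  by rewrite muln0 andbF mul0r.
congr (\det _); apply/matrixP => i j; rewrite !mxE /ab_entry.
have -> : (x + 2 * i.+1 = x.+2 + 2 * i)%N by lia.
have -> : ((x + y.+1 + i.+1 + j).-1 = (x.+2 + y + i + j).-1)%N by lia.
have -> : (y.+1 + 2 * j - i.+1 = y + 2 * j - i)%N by lia.
by rewrite addSn ltnS.
Qed.

Lemma leading_shift_cols x y n : leading (fun i j => ab_entry x y i j.+1) n =
  if x is x'.+1 then leading (ab_entry x' y.+2) n else (n == 0%N)%:R.
Proof.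
case: x n => [|x] [|n]; rewrite /leading ?det_mx00 //.
  by rewrite (expand_det_row _ ord0) big1 // => i _; rewrite mxE /ab_entry muln0 mul0r.
congr (\det _); apply/matrixP => i j; rewrite !mxE /ab_entry.
have -> : (y + 2 * j.+1 = y.+2 + 2 * j)%N by lia.
have -> : ((x.+1 + y + i + j.+1).-1 = (x + y.+2 + i + j).-1)%N by lia.
have -> : (x.+1 + 2 * i - j.+1 = x + 2 * i - j)%N by lia.
by rewrite addSn ltnS.
Qed.

Lemma leading_shift_both x y n :
  leading (fun i j => ab_entry x y i.+1 j.+1) n = leading (ab_entry x.+1 y.+1) n.
Proof.
congr (\det _); apply/matrixP => i j; rewrite !mxE /ab_entry.
have -> : (x + 2 * i.+1 = (x.+1 + 2 * i).+1)%N by lia.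
have -> : (y + 2 * j.+1 = (y.+1 + 2 * j).+1)%N by lia.
have -> : ((x + y + i.+1 + j.+1).-1 = (x.+1 + y.+1 + i + j).-1)%N by lia.
by rewrite !subSS !ltnS.
Qed.

(** Induction by condensation: the central minor is, by induction, a nonzero product and can be
    cancelled. *)
Theorem andrews_burge x y n : (0 < x + y)%N ->
  leading (ab_entry x y) n = ab_prod x y n.
Proof.
have [N le_nN] := ubnP n; elim: N n le_nN x y => // N IHN [|[|n]] lt_nN x y xy_gt0.
- by rewrite /leading det_mx00 /ab_prod big_ord0.
- rewrite /leading det_mx11 mxE /ab_prod big_ord1 /ab_entry /ab_factor.
  rewrite !muln0 !addn0 !subn0 !divff ?fct_neq0 // !mulr1.
  by rewrite (_ : fct (@ord0 0) = 1) ?mul1r.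
have IH x' y' m : (m <= n.+1)%N -> (0 < x' + y')%N ->
    leading (ab_entry x' y') m = ab_prod x' y' m.
  by move=> le_m; apply: IHN; lia.
have Dn := IH x.+1 y.+1 n (leqnSn n) isT.
have nzD : leading (ab_entry x.+1 y.+1) n != 0 by rewrite Dn ab_prod_neq0.
apply: (mulIf nzD); rewrite -leading_shift_both in nzD *.
rewrite condensation // !leading_shift_both leading_shift_rows leading_shift_cols.
rewrite Dn !IH //.
(* [K] is the denominator of the ratio in [ab_prod_shift]. Multiplied by it, the subtracted product
   has one formula that also covers [x = 0] and [y = 0], where both sides vanish. *)
pose K : rat := (x + y + n).+1%:R * (x + 2 * n).+2%:R * (y + 2 * n).+2%:R.
have nzK : K != 0 by rewrite !mulf_neq0 ?pnatr_eq0.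
set X := (X in _ - X); have XE : X * K =
    ab_prod x y n.+1 * ab_prod x.+1 y.+1 n.+1 * ((x + y)%:R * x%:R * y%:R).
  rewrite /X; case: x y {X nzK xy_gt0 Dn nzD} @K => [|x] [|y] K; rewrite /K.
  - by rewrite !mul0r !mulr0.
  - by rewrite !mul0r mulr0 mul0r mulr0.
  - by rewrite !mulr0 mul0r.
  rewrite (IH x y.+3) ?(IH x.+3 y) ?[(x + _.+3)%N]addnS //.
  have := ab_prod_shift x y n.+1; rewrite !addn3 => shift.
  rewrite (_ : (x.+1 + y.+1 + n).+1 = x + y + 2 + n.+1)%N; last by lia.
  rewrite (_ : (x.+1 + 2 * n).+2 = x + 1 + 2 * n.+1)%N; last by lia.
  rewrite (_ : (y.+1 + 2 * n).+2 = y + 1 + 2 * n.+1)%N; last by lia.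
  rewrite (_ : x.+1 + y.+1 = x + y + 2)%N; last by lia.
  by rewrite [ab_prod x _ _ * _]mulrC shift !addn1.
apply: (mulIf nzK); rewrite mulrBl XE.
have -> : ab_prod x y n.+2 = ab_prod x y n.+1 * ab_factor x y n.+1.
  by rewrite /ab_prod big_ord_recr.
have -> : ab_prod x.+1 y.+1 n.+1 = ab_prod x.+1 y.+1 n * ab_factor x.+1 y.+1 n.
  by rewrite /ab_prod big_ord_recr.
have := ab_factor_shift n xy_gt0; rewrite -/K => step.
transitivity (ab_prod x y n.+1 * ab_prod x.+1 y.+1 n * (ab_factor x y n.+1 * K));
  last by ring.
(* With [s = n + 1] this is [(x+y+s)(x+2s)(y+2s) - (x+y)xy = s(2x+y+2s)(x+2y+2s)]. *)
by rewrite step /K; ring.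
Qed.

(** * Evaluation of the Pfaffian *)

Lemma alternating_rev (R : comNzRingType) (V : lmodType R) (Phi : seq V -> R) s1 s :
  multilinear Phi -> alternating Phi ->
  exists b : bool, Phi (s1 ++ rev s) = (-1) ^+ b * Phi (s1 ++ s).
Proof.
move=> lin alt; elim: s s1 => [|x s IHs] s1; first by exists false; rewrite mul1r.
have [b Hb] := IHs (rcons s1 x); exists (b (+) odd (size s)).
rewrite rev_cons -cats1; apply: (can_inj (signrMK (size s))).
have := alternating_move s1 (rev s) x [::] lin alt.
rewrite cats0 size_rev => <-; rewrite -cat_rcons Hb cat_rcons.
by rewrite signr_addb signr_odd -mulrA [RHS]mulrCA signrMK.
Qed.

Lemma binE_fct n m : (m <= n)%N -> ('C(n, m))%:R = fct n / (fct m * fct (n - m)).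
Proof.
move=> le_mn; rewrite /fct -(bin_fact le_mn) !natrM mulfK //.
by rewrite mulf_neq0 ?fct_neq0.
Qed.

Section Eigenbasis.
Variable N : nat.
Let dot : {poly rat} -> {poly rat} -> rat := dotp N.

Definition sympoly k l : {poly rat} := 'X^k * (1 - 'X) ^+ l.
Definition evenvec k := sympoly k k.
(** This equals [(1 - 2X) X^k (1 - X)^k], which changes sign under [X -> 1 - X]. *)
Definition oddvec k := sympoly k k.+1 - sympoly k.+1 k.

Lemma flip_sympoly k l : flip (sympoly k l) = sympoly l k.
Proof.
rewrite /flip /sympoly comp_polyM comp_Xn_poly rmorphXn /= comp_polyB comp_polyX.
by rewrite comp_polyC subKr mulrC.
Qed.

Lemma coef_sympoly k l a :
  (sympoly k l)`_a = if (a < k)%N then 0 else (-1) ^+ (a - k) * ('C(l, a - k))%:R.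
Proof. by rewrite coefXnM; case: ifP => // _; rewrite coef_1subX. Qed.

Lemma sympolyM k l k' l' : sympoly k l * sympoly k' l' = sympoly (k + k') (l + l').
Proof. by rewrite /sympoly mulrACA -!exprD. Qed.

Lemma size_sympoly k l : (size (sympoly k l) <= (k + l).+1)%N.
Proof.
apply/leq_sizeP => a le_a; rewrite coef_sympoly; case: ifP => // _.
by rewrite bin_small ?mulr0 //; lia.
Qed.

(* [evenvec k] is palindromic up to sign, so the pairing is a coefficient of a product. *)
Lemma dotp_evenvec k (g : {poly rat}) : (2 * k < N)%N ->
  dot (evenvec k) g = (-1) ^+ k * (evenvec k * g)`_(3 * k).
Proof.
move=> lt_kN; rewrite /dot /dotp coefMr mulr_sumr.
have le3 : ((2 * k).+1 <= (3 * k).+1)%N by lia.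
transitivity (\sum_(i < (2 * k).+1) (evenvec k)`_i * g`_i).
  rewrite [RHS](big_ord_widen _ (fun i => (evenvec k)`_i * g`_i) lt_kN) [RHS]big_mkcond.
  apply: eq_bigr => i _; case: ltnP => // le_i.
  by rewrite nth_default ?mul0r // (leq_trans (size_sympoly _ _)) //; lia.
rewrite (big_ord_widen _ (fun i => (evenvec k)`_i * g`_i) le3) big_mkcond.
apply: eq_bigr => i _; rewrite mulrA; case: ltnP => [lt_i|le_i].
  congr (_ * _); rewrite !coef_sympoly.
  case: ltnP => le_ik; case: ltnP => le_ik'; rewrite ?mulr0 //.
  - by rewrite bin_small ?mulr0 //; lia.
  - lia.
  rewrite mulrA -exprD -signr_odd -[in RHS]signr_odd.
  rewrite (_ : odd (i - k) = odd (k + (3 * k - i - k))); last by lia.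
  by rewrite -[in RHS]bin_sub; [congr (_ * _%:R); congr ('C(_, _)); lia | lia].
rewrite [(evenvec k)`_ _]coef_sympoly; case: ifP => [_|/negP[]]; rewrite ?mulr0 ?mul0r //.
by have := ltn_ord i; lia.
Qed.

(** Put [a = 2k - l] and [b = 2l - k + 1]. Up to sign the coefficient is [C(a+b, a) + C(a+b-1, a-1)
    = (2a+b) (a+b-1)! / (a! b!)], and [2a + b = 3k + 1]. *)
Lemma dotp_even_odd k l : (2 * k < N)%N ->
  dot (evenvec k) (oddvec l) =
  ((-1) ^+ k * (3 * k + 1)%:R) * ab_entry 0 1 k l * (-1) ^+ l.
Proof.
move=> lt_kN; rewrite dotp_evenvec //.
have -> : evenvec k * oddvec l = sympoly (k + l) (k + l).+1 - sympoly (k + l).+1 (k + l).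
  by rewrite /evenvec /oddvec mulrBr !sympolyM !addnS.
rewrite coefB !coef_sympoly /ab_entry.
have [le_l2k|lt_2kl] := leqP l (2 * k); last first.
  have lt_3k : (3 * k < k + l)%N by lia.
  by rewrite lt_3k ltnS ltnW // subrr !(mulr0, mul0r).
rewrite ltnNge (_ : (k + l <= 3 * k)%N); last by lia.
rewrite (_ : (3 * k - (k + l) = 2 * k - l)%N); last by lia.
have [le_kl|lt_lk] := leqP k (1 + 2 * l); last first.
  rewrite andbF mulr0 mul0r ltnNge.
  rewrite [X in _ * X%:R - _]bin_small ?mulr0; last by lia.
  by case: leqP => // ?; rewrite ?bin_small ?mulr0 ?subr0 ?mulr0 //; lia.
have [a aE] : exists a, (2 * k - l = a)%N by exists (2 * k - l)%N.
have [b bE] : exists b, (1 + 2 * l - k = b)%N by exists (1 + 2 * l - k)%N.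
have signl : (-1) ^+ l = (-1) ^+ a :> rat.
  by rewrite -signr_odd -[RHS]signr_odd; congr (_ ^+ nat_of_bool _); lia.
have kE : (3 * k + 1 = a + (k + l).+1)%N by lia.
have sE : ((k + l).+1 = a + b)%N by lia.
rewrite !add0n aE bE signl kE (_ : (1 + k + l).-1 = (k + l)%N) // sE.
(* For [a = 0] the second binomial would have lower index -1; the corresponding polynomial starts
   above degree [3k] and contributes nothing. *)
case: a aE {signl kE} sE => [|a] aE sE /=.
  rewrite (_ : (3 * k < 0 + b)%N); last by lia.
  rewrite subr0 bin0 !mulr1 -(sE : _ = b) fctS; have -> : fct 0 = 1 by [].
  rewrite !add0n mul1r -mulrA [X in _ * X](_ : _ = 1) ?mulr1 //.
  by rewrite mulrA divff // mulf_neq0 ?fct_neq0 ?pnatr_eq0.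
rewrite ifN; last by lia.
rewrite (_ : (3 * k - (a.+1 + b))%N = a); last by lia.
rewrite (_ : (k + l)%N = (a + b)%N); last by lia.
rewrite !binE_fct ?leq_addr // addKn addKn addSn !fctS exprS.
have ? := fct_neq0 a; have ? := fct_neq0 b.
have a0 := ler0n rat a; have b0 := ler0n rat b.
field.
by do ?[apply/andP; split] => //; apply: lt0r_neq0; lra.
Qed.

Let beta : {poly rat} -> {poly rat} -> rat := skewform N.

Lemma flip_even k : flip (evenvec k) = evenvec k.
Proof. exact: flip_sympoly. Qed.

Lemma flip_odd k : flip (oddvec k) = - oddvec k.
Proof. by rewrite {1}/flip comp_polyB -!/(flip _) !flip_sympoly opprB. Qed.

Lemma dotpN (f g : {poly rat}) : dot f (- g) = - dot f g.
Proof. by rewrite /dot /dotp -sumrN; apply: eq_bigr => i _; rewrite coefN mulrN. Qed.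

Lemma beta_even_even k l : beta (evenvec k) (evenvec l) = 0.
Proof. by rewrite /beta /skewform !flip_even subrr. Qed.

Lemma beta_odd_odd k l : beta (oddvec k) (oddvec l) = 0.
Proof.
rewrite /beta /skewform !flip_odd dotpC -!/(dot _ _) !dotpN.
by rewrite /dot [dotp _ (oddvec l) _]dotpC subrr.
Qed.

Lemma beta_even_odd k l : beta (evenvec k) (oddvec l) = 2 * dot (evenvec k) (oddvec l).
Proof. by rewrite /beta /skewform flip_even flip_odd -!/(dot _ _) dotpN; ring. Qed.

End Eigenbasis.

Section Evaluation.
Variable n : nat.
Let N := (2 * n)%N.
Let beta : {poly rat} -> {poly rat} -> rat := skewform N.
Let lin := pf_multilinear (@skewform_linl rat N) (@skewform_linr rat N).
Let alt := pf_alternating (@skewform_alt rat N).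

(** The even and odd vectors are interleaved so that index and degree agree, as [triangular_change]
    requires. *)
Let eigenvec i := if odd i then oddvec i./2 else evenvec i./2.

Lemma size_eigenvec i : (size (eigenvec i) <= i.+1)%N.
Proof.
rewrite /eigenvec; case: ifP => odd_i; last first.
  by apply: leq_trans (size_sympoly _ _) _; lia.
apply: leq_trans (size_polyD _ _) _; rewrite size_polyN geq_max.
by apply/andP; split; apply: leq_trans (size_sympoly _ _) _; lia.
Qed.

(** The even and odd vectors with index [k] have leading coefficients [(-1)^k] and [-2 (-1)^k],
    whose product is -2. *)
Lemma lead_eigenvec m : \prod_(i < 2 * m) (eigenvec i)`_i = (- 2) ^+ m.
Proof.
elim: m => [|m IHm]; first by rewrite big_ord0.
rewrite mulnS !big_ord_recr /= IHm exprSr -mulrA; congr (_ * _).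
rewrite /eigenvec mul2n /= odd_double /= uphalf_double doubleK.
rewrite coefB !coef_sympoly -addnn ltnNge leq_addr addnK binn.
rewrite ltnNge -addnS leq_addr ltnNge addnS -addSn leq_addr /=.
rewrite addSn -addnS !addKn -[(m + m.+1)%N]addSnnS addKn !binn !mulr1 exprS.
by rewrite mulrBr mulrCA -expr2 sqrr_sign; ring.
Qed.

Lemma eigenvec_pairs m : [seq eigenvec i | i <- iota 0 (2 * m)] =
  flatten [seq [:: p.1; p.2] | p <- [seq (evenvec k, oddvec k) | k <- iota 0 m]].
Proof.
elim: m => // m IHm; rewrite mulnSr iotaD map_cat IHm -(addn1 m) iotaD !map_cat flatten_cat.
by rewrite /= add0n mul2n /eigenvec /= odd_double /= uphalf_double doubleK.
Qed.

(** Sorting the even vectors before the odd ones gives two isotropic halves. The row and column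
    factors split off as diagonal matrices; the power of 2 comes from [beta_even_odd] and will
    cancel against [lead_eigenvec]. *)
Lemma norm_pf_eigenvec : `|pf beta [seq eigenvec i | i <- rev (iota 0 N)]| =
  2 ^+ n * (\prod_(i < n) (3 * i + 1)%:R) * `|leading (ab_entry 0 1) n|.
Proof.
have [b1] := alternating_rev [::] [seq eigenvec i | i <- iota 0 N] lin alt.
rewrite map_rev /= => ->; rewrite normrMsign eigenvec_pairs.
have [b2] := alternating_pairs [seq (evenvec k, oddvec k) | k <- iota 0 n] [::] lin alt.
rewrite /= => ->; rewrite normrMsign /unzip1 /unzip2 -!map_comp.
have codomE (f : nat -> {poly rat}) : [seq f k | k <- iota 0 n] = codom (fun i : 'I_n => f i).
  by rewrite codomE (map_comp f val) val_enum_ord.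
have := pf_isotropic (fun i j : 'I_n => beta_even_even N i j)
  (fun i j : 'I_n => beta_odd_odd N i j).
rewrite -!codomE => ->.
rewrite normrMsign.
pose a : 'rV[rat]_n := \row_i ((-1) ^+ i * (3 * i + 1)%:R).
pose c : 'rV[rat]_n := \row_i (-1) ^+ i.
have -> : \matrix_(i, j) skewform N (evenvec (val i)) (oddvec (val j)) =
    2 *: (diag_mx a *m (\matrix_(i < n, j < n) ab_entry 0 1 i j) *m diag_mx c).
  apply/matrixP => i j; rewrite mul_diag_mx mul_mx_diag !mxE.
  rewrite [LHS]beta_even_odd dotp_even_odd //.
  by rewrite ltn_pmul2l //; apply: ltn_ord.
rewrite detZ !det_mulmx !det_diag !normrM normrX (ger0_norm (ler0n _ 2)).
rewrite -[RHS]mulrA; congr (_ * _); rewrite mulrAC -normrM -big_split normr_prod.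
congr (_ * _); apply: eq_bigr => i _; rewrite !mxE /=.
by rewrite mulrAC -expr2 sqrr_sign mul1r ger0_norm ?ler0n.
Qed.

(** In reverse order the ring vectors are unitriangular: [rowvec] at position [i] has degree
    [N - 1 - i] and leading coefficient [C(i, i)]. *)
Lemma pf_rowvec : pf beta [seq rowvec rat N i | i <- iota 0 N] =
  pf beta [seq 'X^i | i <- rev (iota 0 N)].
Proof.
pose w i := rowvec rat N (N.-1 - i).
have -> : [seq rowvec rat N i | i <- iota 0 N] = [seq w i | i <- rev (iota 0 N)].
  apply: (@eq_from_nth _ 0); rewrite ?size_map ?size_rev ?size_iota // => i lt_iN.
  rewrite !(nth_map 0%N) ?size_rev ?size_iota // nth_rev ?size_iota //.
  by rewrite !nth_iota //; [rewrite /w; congr rowvec; lia | lia].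
rewrite [LHS](triangular_change lin alt (w := w) [::]) => [|i lt_iN]; last first.
  apply/leq_sizeP => k lt_ik; rewrite coef_poly; case: ifP => // lt_kN.
  by rewrite bin_small //; lia.
rewrite big1 ?mul1r // => i _; rewrite coef_poly ltn_ord binn //.
Qed.

Lemma pf_rowvec_norm : `|pf beta [seq rowvec rat N i | i <- iota 0 N]| =
  (\prod_(i < n) (3 * i + 1)%:R) * ab_prod 0 1 n.
Proof.
have := norm_pf_eigenvec; rewrite andrews_burge //.
rewrite [X in `|X| = _](triangular_change lin alt (w := eigenvec) [::]); last first.
  by move=> i _; apply: size_eigenvec.
rewrite lead_eigenvec pf_rowvec normrM normrX normrN (ger0_norm (ler0n _ 2)) -mulrA.
move/(mulfI (expf_neq0 _ (_ : 2 != 0 :> rat))) => ->//; congr (_ * _).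
apply: ger0_norm; apply: prodr_ge0 => i _.
by rewrite !(mulr_ge0, invr_ge0, ler0n).
Qed.

End Evaluation.

(** Both sides are the product of all factorials [j!] with [j < 2n]. *)
Lemma prod_fct_shift n : \prod_(i < n) fct (n + i) * \prod_(i < n) fct i =
  \prod_(i < n) (fct (2 * i) * fct (2 * i).+1).
Proof.
elim: n => [|n IHn]; first by rewrite !big_ord0 mul1r.
rewrite [RHS]big_ord_recr -IHn /= [X in _ * X]big_ord_recr big_ord_recr /=.
have shift : \prod_(i < n) fct (n.+1 + i) * fct n = \prod_(i < n) fct (n + i) * fct (2 * n).
  transitivity (\prod_(i < n.+1) fct (n + i)).
    rewrite big_ord_recl mulrC /= addn0; congr (_ * _).
    by apply: eq_bigr => i _; rewrite addSnnS.
  by rewrite big_ord_recr /= mul2n addnn.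
rewrite [X in _ * X = _]mulrC mulrACA shift (_ : (n.+1 + n = (2 * n).+1)%N); last by lia.
by ring.
Qed.

Lemma stacks_formula n :
  (size (stacks (2 * n) (nseq (2 * n) true)))%:R =
  (\prod_(0 <= i < n) (((3 * i + 1)`!)%:R / ((n + i)`!)%:R)) ^+ 2 :> rat.
Proof.
have szE := @size_stacks rat (2 * n) (2 * n) (nseq (2 * n) true) (leqnn _) (size_nseq _ _).
(* A count is nonnegative, so the absolute value of the Pfaffian determines it. *)
rewrite -[LHS]ger0_norm ?ler0n // szE.
have -> f N p : select f p (nseq N true) = [seq f i | i <- iota p N] :> seq {poly rat}.
  by elim: N p => //= N IHN p; rewrite IHN.
rewrite pf_rowvec_norm /ab_prod -big_split big_mkord /=.
(* The factorials [(n + i)!] are redistributed so that the remaining identity holds factor by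
   factor. *)
have -> : \prod_(i < n) (((3 * i + 1)`!)%:R / ((n + i)`!)%:R) =
    \prod_(i < n) (fct i * fct (3 * i + 1) / (fct (2 * i) * fct (2 * i).+1)).
  have nz m (h : nat -> nat) : \prod_(i < m) fct (h i) != 0.
    by apply/prodf_neq0 => i _; apply: fct_neq0.
  rewrite !prodf_div big_split /= -prod_fct_shift -!/(fct _).
  by rewrite [X in _ = X / _]mulrC invfM mulrACA divff ?mulr1 // (nz n id).
rewrite expr2 -big_split; apply: eq_bigr => i _ /=; rewrite /ab_factor.
rewrite (_ : (0 + 1 + i).-1 = i) //.
rewrite (_ : (2 * 0 + 1 + 3 * i).-1 = 3 * i)%N // (_ : (2 * 0 + 1 + 2 * i).-1 = 2 * i)%N //.
rewrite (_ : (0 + 2 * 1 + 3 * i).-1 = (3 * i).+1)%N //.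
rewrite (_ : (0 + 2 * 1 + 2 * i).-1 = (2 * i).+1)%N //.
rewrite (_ : (0 + 2 * i = 2 * i)%N) // add1n addn1 !fctS.
have := fct_neq0 i; have := fct_neq0 (2 * i); have := fct_neq0 (3 * i).
have i0 := ler0n rat i => ? ? ?; field.
by do ?[apply/andP; split] => //; apply: lt0r_neq0; lra.
Qed.

(** * Unit triangles and lozenges *)

Local Open Scope fset_scope.
Local Open Scope ring_scope.

Definition up (x y : int) : triangle := [fset (x, y); (x + 1, y); (x, y + 1)].
Definition dn (x y : int) : triangle := [fset (x + 1, y); (x, y + 1); (x + 1, y + 1)].

Definition unit_step (x y : int) :=
  x = 1 /\ y = 0 \/ x = 0 /\ y = 1 \/ x = -1 /\ y = 1 \/
  x = -1 /\ y = 0 \/ x = 0 /\ y = -1 \/ x = 1 /\ y = -1.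

Lemma sqdist_unit (x y : int) : x ^+ 2 + x * y + y ^+ 2 = 1 -> unit_step x y.
Proof.
move=> d1; have [x1 y1] : (-1 <= x <= 1) /\ (-1 <= y <= 1) by split; nia.
have : x = -1 \/ x = 0 \/ x = 1 by lia.
have : y = -1 \/ y = 0 \/ y = 1 by lia.
by rewrite /unit_step; case=> [?|[?|?]] [?|[?|?]]; subst x y; lia.
Qed.

Lemma triangle_ext (s t : triangle) :
  (forall z w : int, ((z, w) \in s) = ((z, w) \in t)) -> s = t.
Proof. by move=> eq_st; apply/fsetP => -[z w]. Qed.

Lemma fset3P (T : choiceType) (A : {fset T}) : #|` A| = 3%N ->
  exists a b c, [/\ a != b, a != c, b != c & A = [fset a; b; c]].
Proof.
move=> cardA; have mem_s x : (x \in A) = (x \in enum_fset A) by [].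
have us := fset_uniq A; rewrite /= in cardA.
case: (enum_fset A) us mem_s cardA => [|a [|b [|c [|]]]] //= us mem_s _.
move: us; rewrite !inE negb_or andbT => /andP[/andP[ab ac] bc].
exists a, b, c; split=> //; apply/fsetP => x.
by rewrite mem_s !inE orbA.
Qed.

Lemma unit_steps_triangle (a1 a2 b1 b2 c1 c2 : int) :
  unit_step (b1 - a1) (b2 - a2) -> unit_step (c1 - a1) (c2 - a2) ->
  unit_step (c1 - b1) (c2 - b2) ->
  exists x y, [fset (a1, a2); (b1, b2); (c1, c2)] = up x y \/
              [fset (a1, a2); (b1, b2); (c1, c2)] = dn x y.
Proof.
case=> [|[|[|[|[|]]]]] [h1 h2]; case=> [|[|[|[|[|]]]]] [h3 h4] h5;
  try (exfalso; rewrite /unit_step in h5; lia).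
all: have [-> ->] : b1 = a1 + (b1 - a1) /\ b2 = a2 + (b2 - a2) by split; ring.
all: have [-> ->] : c1 = a1 + (c1 - a1) /\ c2 = a2 + (c2 - a2) by split; ring.
all: rewrite h1 h2 h3 h4 {h1 h2 h3 h4 h5}.
(* Each selector makes its goals adjacent, which renumbers the later ones. *)
1,3: exists a1, a2; left.
4,5: exists (a1 - 1), a2; right.
6,7: exists (a1 - 1), a2; left.
8,9: exists (a1 - 1), (a2 - 1); right.
3,11: exists a1, (a2 - 1); right.
11,12: exists a1, (a2 - 1); left.
all: by apply: triangle_ext => z w; rewrite !inE !xpair_eqE; lia.
Qed.

Lemma unit_triangleP (t : triangle) :
  reflect (exists x y, t = up x y \/ t = dn x y) (is_unit_triangle t).
Proof.
apply: (iffP andP) => [[/eqP /fset3P [[a1 a2] [[b1 b2] [[c1 c2] [ab ac bc ->]]]]]|].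
  move=> /forallP dist.
  have dist1 p q : p \in [fset (a1, a2); (b1, b2); (c1, c2)] ->
      q \in [fset (a1, a2); (b1, b2); (c1, c2)] -> p != q -> sqdist p q = 1.
    move=> pin qin ne_pq; have /forallP/(_ [` qin]) := dist [` pin].
    by rewrite /= ne_pq => /eqP.
  have /sqdist_unit Dab : sqdist (b1, b2) (a1, a2) = 1.
    by apply: dist1; rewrite ?inE ?eqxx ?orbT // eq_sym.
  have /sqdist_unit Dac : sqdist (c1, c2) (a1, a2) = 1.
    by apply: dist1; rewrite ?inE ?eqxx ?orbT // eq_sym.
  have /sqdist_unit Dbc : sqdist (c1, c2) (b1, b2) = 1.
    by apply: dist1; rewrite ?inE ?eqxx ?orbT // eq_sym.
  exact: unit_steps_triangle Dab Dac Dbc.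
case=> x [y]; suff H (a b c : point) : a != b -> a != c -> b != c ->
    sqdist a b == 1 -> sqdist a c == 1 -> sqdist b c == 1 ->
    #|` [fset a; b; c]| == 3 /\
    [forall p : [fset a; b; c], forall q : [fset a; b; c],
      (val p != val q) ==> (sqdist (val p) (val q) == 1)].
  by case=> ->; apply: H; rewrite ?xpair_eqE /sqdist /=; lia.
move=> ab ac bc dab dac dbc; split.
  by rewrite -fsetUA cardfsU1 !inE cardfs2 bc negb_or ab ac.
have sqdistC p q : sqdist p q = sqdist q p by rewrite /sqdist /=; ring.
apply/forallP => -[p pin]; apply/forallP => -[q qin] /=.
by move: pin qin; rewrite !inE => /orP[/orP[]|] /eqP-> /orP[/orP[]|] /eqP->;
   rewrite ?eqxx // sqdistC ?dab ?dac ?dbc ?implybT // sqdistC ?dab ?dac ?dbc ?implybT.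
Qed.

Lemma up_unit x y : is_unit_triangle (up x y).
Proof. by apply/unit_triangleP; exists x, y; left. Qed.

Lemma dn_unit x y : is_unit_triangle (dn x y).
Proof. by apply/unit_triangleP; exists x, y; right. Qed.

Lemma card_fset3I (T : choiceType) (a b c : T) (B : {fset T}) :
    a != b -> a != c -> b != c ->
  #|` [fset a; b; c] `&` B| = ((a \in B) + (b \in B) + (c \in B))%N.
Proof.
move=> ab ac bc; set X := _ `&` B.
rewrite (cardfsD1 a X) (cardfsD1 b (X `\ a)) (cardfsD1 c (X `\ a `\ b)).
have -> : X `\ a `\ b `\ c = fset0.
  apply/fsetP => z; rewrite !inE.
  by case: (z == a); case: (z == b); case: (z == c).
rewrite cardfs0 addn0 addnA; congr (_ + _ + _)%N; rewrite /X !inE eqxx ?orbT //.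
  by rewrite eq_sym ab.
by rewrite ![c == _]eq_sym ac bc.
Qed.

(** The direction [k] names the shared edge of the upward triangle: 0 is opposite the vertex
    [(x, y)], 1 and 2 leave that vertex along 1 and along [w]. *)
Definition loz (x y : int) (k : nat) : lozenge :=
  [fset up x y; dn (x - (k == 2)%:Z) (y - (k == 1)%:Z)].

Lemma card_upI x y (B : triangle) : #|` up x y `&` B| =
  (((x, y) \in B) + (((x + 1)%R, y) \in B) + ((x, (y + 1)%R) \in B))%N.
Proof. by apply: card_fset3I; rewrite xpair_eqE; lia. Qed.

Lemma card_dnI x y (B : triangle) : #|` dn x y `&` B| =
  ((((x + 1)%R, y) \in B) + ((x, (y + 1)%R) \in B) + (((x + 1)%R, (y + 1)%R) \in B))%N.
Proof. by apply: card_fset3I; rewrite xpair_eqE; lia. Qed.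

Lemma mem_up (x y z w : int) : ((z, w) \in up x y) =
  [|| (z == x) && (w == y), (z == x + 1) && (w == y) | (z == x) && (w == y + 1)].
Proof. by rewrite !inE !xpair_eqE orbA. Qed.

Lemma mem_dn (x y z w : int) : ((z, w) \in dn x y) =
  [|| (z == x + 1) && (w == y), (z == x) && (w == y + 1) | (z == x + 1) && (w == y + 1)].
Proof. by rewrite !inE !xpair_eqE orbA. Qed.

(** Triangles of equal orientation have none, one or all of their vertices in common. Two common
    vertices thus force opposite orientations and leave three relative positions. *)
Lemma lozengeP (l : lozenge) :
  reflect (exists x y k, (k < 3)%N /\ l = loz x y k) (is_lozenge l).
Proof.
apply: (iffP existsP) => [[[t tl]] /existsP[[u ul]] /=|[x [y [k [k3 ->]]]]].
  case/and4P => /eqP l_tu /unit_triangleP[x [y t_eq]] /unit_triangleP[z [w u_eq]].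
  have updn x1 y1 x2 y2 : #|` up x1 y1 `&` dn x2 y2| = 2%N ->
      exists x y k, (k < 3)%N /\ [fset up x1 y1; dn x2 y2] = loz x y k.
    rewrite card_upI !mem_dn => card2; exists x1, y1.
    have [[-> ->]|[[-> ->]|[-> ->]]] : (x2 = x1 /\ y2 = y1) \/ (x2 = x1 /\ y2 = y1 - 1) \/
       (x2 = x1 - 1 /\ y2 = y1) by lia.
    - by exists 0%N; rewrite /loz /= !subr0.
    - by exists 1%N; rewrite /loz /= !subr0.
    by exists 2; rewrite /loz /= !subr0.
  move=> /eqP; rewrite l_tu {l_tu tl ul}.
  case: t_eq u_eq => -> [] -> card2.
  - by exfalso; move: card2; rewrite card_upI !mem_up; lia.
  - exact: updn.
  - by rewrite fsetUC; apply: updn; rewrite fsetIC.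
  by exfalso; move: card2; rewrite card_dnI !mem_dn; lia.
have tl : up x y \in loz x y k by rewrite !inE eqxx.
have ul : dn (x - (k == 2)%:Z) (y - (k == 1)%:Z) \in loz x y k by rewrite !inE eqxx orbT.
exists [` tl]; apply/existsP; exists [` ul]; rewrite /= eqxx up_unit dn_unit /=.
by rewrite card_upI !mem_dn; lia.
Qed.

Lemma up_inj x y z w : up x y = up z w -> x = z /\ y = w.
Proof.
move=> eq_up.
have := mem_up z w x y; rewrite -eq_up mem_up !eqxx /= => /esym e1.
have := mem_up x y z w; rewrite eq_up mem_up !eqxx /= => /esym e2.
by lia.
Qed.

Lemma dn_inj x y z w : dn x y = dn z w -> x = z /\ y = w.
Proof.
move=> eq_dn.
have := mem_dn z w (x + 1) (y + 1); rewrite -eq_dn mem_dn !eqxx /= !orbT => /esym e1.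
have := mem_dn x y (z + 1) (w + 1); rewrite eq_dn mem_dn !eqxx /= !orbT => /esym e2.
by lia.
Qed.

Lemma up_neq_dn x y z w : up x y <> dn z w.
Proof.
move=> eq_ud.
have := mem_dn z w x y; rewrite -eq_ud mem_up !eqxx /= => /esym e1.
have := mem_dn z w (x + 1) y; rewrite -eq_ud mem_up !eqxx /= orbT => /esym e2.
have := mem_dn z w x (y + 1); rewrite -eq_ud mem_up !eqxx /= !orbT => /esym e3.
by lia.
Qed.

(** * Invariant tilings of the hexagon *)

Section Hexagon.
Variable N : nat.

(* Triangles and lozenges in coordinates relative to the centre of the hexagon. *)
Definition cup (x y : int) := up x (y + N%:Z).
Definition cdn (x y : int) := dn x (y + N%:Z).
(* The lozenge [cloz x y k] joins [cup x y] to its neighbour in direction [k]. *)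
Definition dx (k : nat) : int := (k == 2)%:Z.
Definition dy (k : nat) : int := (k == 1)%:Z.
Definition cloz (x y : int) (k : nat) : lozenge := [fset cup x y; cdn (x - dx k) (y - dy k)].

Lemma loz_cloz x y k : loz x y k = cloz x (y - N%:Z) k.
Proof.
rewrite /cloz /cup /cdn subrK.
by have -> : y - N%:Z - dy k + N%:Z = y - dy k by ring.
Qed.

Lemma cup_inj x y z w : cup x y = cup z w -> x = z /\ y = w.
Proof. by case/up_inj => -> /addIr ->. Qed.

Lemma cdn_inj x y z w : cdn x y = cdn z w -> x = z /\ y = w.
Proof. by case/dn_inj => -> /addIr ->. Qed.

Lemma cup_mem x y z w k : cup z w \in cloz x y k -> z = x /\ w = y.
Proof. by rewrite !inE => /orP[] /eqP => [/cup_inj|/up_neq_dn]. Qed.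

Lemma cdn_mem x y z w k : cdn z w \in cloz x y k -> z = x - dx k /\ w = y - dy k.
Proof. by rewrite !inE => /orP[] /eqP => [/esym/up_neq_dn|/cdn_inj]. Qed.

Lemma cloz_inj x y k z w j : (k < 3)%N -> (j < 3)%N ->
  cloz x y k = cloz z w j -> [/\ x = z, y = w & k = j].
Proof.
move=> k3 j3 eq_l.
have /cup_mem[xz yw] : cup x y \in cloz z w j by rewrite -eq_l !inE eqxx.
have /cdn_mem[] : cdn (x - dx k) (y - dy k) \in cloz z w j.
  by rewrite -eq_l !inE eqxx orbT.
rewrite xz yw /dx /dy => eqx eqy; split=> //.
by move: k3 j3 eqx eqy; clear; lia.
Qed.

Lemma mem_hexagon_points (z w : int) : ((z, w) \in hexagon_points N N N) =
  [&& - N%:Z <= z <= N%:Z, 0 <= w <= (N + N)%:Z & 0 <= z + w <= (N + N)%:Z].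
Proof.
rewrite /hexagon_points !inE; apply/andP/idP => [[/imfset2P]|zw].
  case=> i iN [j jN [-> ->]]; rewrite !inE !mem_iota in iN jN *.
  by move: (i : nat) (j : nat) iN jN => a b aN bN /=; lia.
split; last by move: zw => /=; lia.
apply/imfset2P; exists (absz (z + N%:Z)); first by rewrite inE mem_iota; lia.
exists (absz w); first by rewrite inE mem_iota; lia.
by congr pair; lia.
Qed.

Definition in_up (x y : int) :=
  [&& - N%:Z <= x < N%:Z, - N%:Z <= y < N%:Z & - N%:Z <= x + y < N%:Z].
Definition in_dn (x y : int) :=
  [&& - N%:Z <= x < N%:Z, - N%:Z <= y < N%:Z & - N%:Z <= x + y + 1 < N%:Z].

Lemma cup_hexagon x y : (cup x y \in hexagon N N N) = in_up x y.
Proof.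
rewrite /hexagon !inE /= fpowersetE up_unit andbT /in_up.
apply/fsubsetP/idP => [sub|xy [z w]]; last first.
  by rewrite mem_up mem_hexagon_points; lia.
have := sub (x, y + N%:Z); have := sub (x + 1, y + N%:Z); have := sub (x, y + N%:Z + 1).
by rewrite !mem_up !mem_hexagon_points !eqxx /= ?orbT; lia.
Qed.

Lemma cdn_hexagon x y : (cdn x y \in hexagon N N N) = in_dn x y.
Proof.
rewrite /hexagon !inE /= fpowersetE dn_unit andbT /in_dn.
apply/fsubsetP/idP => [sub|xy [z w]]; last first.
  by rewrite mem_dn mem_hexagon_points; lia.
have := sub (x + 1, y + N%:Z + 1); have := sub (x + 1, y + N%:Z); have := sub (x, y + N%:Z + 1).
by rewrite !mem_dn !mem_hexagon_points !eqxx /= ?orbT; lia.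
Qed.

Lemma hexagonP t : t \in hexagon N N N ->
  exists x y, (t = cup x y /\ in_up x y) \/ (t = cdn x y /\ in_dn x y).
Proof.
move=> tH; have : is_unit_triangle t by move: tH; rewrite !inE => /andP[].
case/unit_triangleP => x [y] t_eq; exists x, (y - N%:Z).
by case: t_eq tH => -> tH; [left | right];
  rewrite -?cup_hexagon -?cdn_hexagon /cup /cdn subrK.
Qed.

Lemma cloz_is_lozenge x y k : (k < 3)%N -> is_lozenge (cloz x y k).
Proof.
move=> k3; apply/lozengeP; exists x, (y + N%:Z), k; split=> //.
by rewrite loz_cloz addrK.
Qed.

(** An exact cover, stated separately for the two orientations. A downward triangle is reached
    through the upward half of its lozenge, hence the shifts by [dx k] and [dy k]. *)
Record hexagon_tiling (T : tiling) : Prop := HexagonTiling {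
  ht_lozenge : forall l, l \in T -> exists x y k, (k < 3)%N /\ l = cloz x y k;
  ht_in : forall x y k, (k < 3)%N -> cloz x y k \in T ->
    in_up x y /\ in_dn (x - dx k) (y - dy k);
  ht_up : forall x y, in_up x y -> exists2 k, (k < 3)%N & cloz x y k \in T;
  ht_up_uniq : forall x y k j, (k < 3)%N -> (j < 3)%N ->
    cloz x y k \in T -> cloz x y j \in T -> k = j;
  ht_dn : forall x y, in_dn x y ->
    exists2 k, (k < 3)%N & cloz (x + dx k) (y + dy k) k \in T;
  ht_dn_uniq : forall x y k j, (k < 3)%N -> (j < 3)%N ->
    cloz (x + dx k) (y + dy k) k \in T -> cloz (x + dx j) (y + dy j) j \in T -> k = j }.

Lemma cdn_cloz x y k : cdn x y \in cloz (x + dx k) (y + dy k) k.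
Proof. by rewrite !inE !addrK eqxx orbT. Qed.

Lemma cup_cloz x y k : cup x y \in cloz x y k.
Proof. by rewrite !inE eqxx. Qed.

Lemma tilingsP T : T \in tilings (hexagon N N N) <-> hexagon_tiling T.
Proof.
split.
  rewrite !inE => /andP[_ /and3P[/forallP lozT /trivIfsetP triv /eqP cover]].
  have T_lozenge l : l \in T -> exists x y k, (k < 3)%N /\ l = cloz x y k.
    move=> lT; have /lozengeP[x [y [k [k3 l_eq]]]] := lozT [` lT].
    by exists x, (y - N%:Z), k; split=> //; rewrite -loz_cloz.
  have sub l t : l \in T -> t \in l -> t \in hexagon N N N.
    by move=> lT tl; rewrite -cover; apply/bigfcupP; exists l; rewrite ?lT.
  have meet l1 l2 t : l1 \in T -> l2 \in T -> t \in l1 -> t \in l2 -> l1 = l2.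
    move=> l1T l2T tl1 tl2; apply/eqP; apply: contraT => /(triv _ _ l1T l2T).
    by move=> /fdisjointP/(_ _ tl1); rewrite tl2.
  split=> //.
  - move=> x y k k3 lT; rewrite -cup_hexagon -cdn_hexagon.
    by split; apply: sub lT _; rewrite !inE eqxx ?orbT.
  - move=> x y; rewrite -cup_hexagon -cover => /bigfcupP[l]; rewrite andbT => lT.
    have [z [w [k [k3 l_eq]]]] := T_lozenge _ lT.
    by rewrite l_eq in lT *; move=> /cup_mem[-> ->]; exists k.
  - move=> x y k j k3 j3 kT jT.
    by have [] := cloz_inj k3 j3 (meet _ _ _ kT jT (cup_cloz x y k) (cup_cloz x y j)).
  - move=> x y; rewrite -cdn_hexagon -cover => /bigfcupP[l]; rewrite andbT => lT.
    have [z [w [k [k3 l_eq]]]] := T_lozenge _ lT.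
    by rewrite l_eq in lT *; move=> /cdn_mem[-> ->]; exists k; rewrite ?subrK.
  move=> x y k j k3 j3 kT jT.
  by have [] := cloz_inj k3 j3 (meet _ _ _ kT jT (cdn_cloz x y k) (cdn_cloz x y j)).
case=> T_lozenge T_in T_up T_up_uniq T_dn T_dn_uniq.
have sub l t : l \in T -> t \in l -> t \in hexagon N N N.
  move=> lT; have [x [y [k [k3 l_eq]]]] := T_lozenge _ lT.
  rewrite l_eq in lT *; have [] := T_in _ _ _ k3 lT.
  by rewrite -cup_hexagon -cdn_hexagon => upH dnH /fset2P[]->.
rewrite !inE fpowersetE; apply/andP; split.
  by apply/fsubsetP => l lT; rewrite fpowersetE; apply/fsubsetP => t; apply: sub lT.
apply/and3P; split.
- apply/forallP => -[l lT] /=; have [x [y [k [k3 ->]]]] := T_lozenge _ lT.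
  exact: cloz_is_lozenge.
- apply/trivIfsetP => l1 l2 l1T l2T; rewrite -fsetI_eq0.
  apply: contraNT => /fset0Pn[t]; rewrite inE => /andP[tl1 tl2].
  have [x [y [k [k3 l1_eq]]]] := T_lozenge _ l1T.
  have [z [w [j [j3 l2_eq]]]] := T_lozenge _ l2T.
  subst l1 l2; apply/eqP.
  move: tl1 => /fset2P[] t_eq; rewrite t_eq in tl2.
    have [xz yw] := cup_mem tl2; rewrite -{}xz -{}yw in l2T *.
    by rewrite (T_up_uniq _ _ _ _ k3 j3 l1T l2T).
  have [xz yw] := cdn_mem tl2.
  have := @T_dn_uniq (x - dx k) (y - dy k) k j k3 j3; rewrite !subrK xz yw !subrK.
  by move=> /(_ l1T l2T) kj; move: xz yw; rewrite kj => /addIr-> /addIr->.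
apply/eqP/fsetP => t; apply/bigfcupP/idP => [[l]|tH].
  by rewrite andbT => lT; apply: sub.
have [x [y [[t_eq /T_up[k k3 lT]]|[t_eq /T_dn[k k3 lT]]]]] := hexagonP tH.
  by exists (cloz x y k); rewrite ?lT // t_eq cup_cloz.
by exists (cloz (x + dx k) (y + dy k) k); rewrite ?lT // t_eq cdn_cloz.
Qed.

End Hexagon.

(** * Rotations about the centre of the hexagon *)

Section Rotation.
Variable N : nat.
Let o := hexagon_center N.

Lemma imfset_fset2 (T K : choiceType) (f : T -> K) (a b : T) :
  [fset f x | x in [fset a; b]] = [fset f a; f b].
Proof.
apply/fsetP => y; apply/imfsetP/fset2P => [[x /fset2P[] -> ->]|[]->]; [by left | by right | |].
  by exists a; rewrite ?inE ?eqxx.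
by exists b; rewrite ?inE ?eqxx ?orbT.
Qed.

Lemma imfset_fset3 (T K : choiceType) (f : T -> K) (a b c : T) :
  [fset f x | x in [fset a; b; c]] = [fset f a; f b; f c].
Proof.
apply/fsetP => y; rewrite !inE; apply/imfsetP/idP => /=.
  by case=> x; rewrite !inE => /orP[/orP[]|] /eqP-> ->; rewrite eqxx ?orbT.
by case/orP => [/orP[]|] /eqP ->; [exists a | exists b | exists c];
  rewrite ?inE ?eqxx ?orbT.
Qed.

Lemma rot_pointD j k p : rot_point o (j + k) p = rot_point o j (rot_point o k p).
Proof.
by rewrite /rot_point iterD [o + iter k mulw _ - o]addrC addKr.
Qed.

Lemma rot_point6 p : rot_point o 6 p = p.
Proof.
case: p => x y; rewrite /rot_point /mulw /=.
by congr pair => /=; ring.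
Qed.

Lemma rot_triangleD j k t : rot_triangle o (j + k) t = rot_triangle o j (rot_triangle o k t).
Proof.
rewrite /rot_triangle -imfset_comp; apply: eq_imfset => // p.
exact: rot_pointD.
Qed.

Lemma rot_lozengeD j k l : rot_lozenge o (j + k) l = rot_lozenge o j (rot_lozenge o k l).
Proof.
rewrite /rot_lozenge -imfset_comp; apply: eq_imfset => // t.
exact: rot_triangleD.
Qed.

Lemma rot_tilingD j k T : rot_tiling o (j + k) T = rot_tiling o j (rot_tiling o k T).
Proof.
rewrite /rot_tiling -imfset_comp; apply: eq_imfset => // l.
exact: rot_lozengeD.
Qed.

Lemma rot_triangle6 t : rot_triangle o 6 t = t.
Proof.
rewrite /rot_triangle -[RHS]imfset_id; apply: eq_imfset => // p.
exact: rot_point6.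
Qed.

Lemma rot_lozenge6 l : rot_lozenge o 6 l = l.
Proof.
rewrite /rot_lozenge -[RHS]imfset_id; apply: eq_imfset => // p.
exact: rot_triangle6.
Qed.

Lemma rot_tiling6 T : rot_tiling o 6 T = T.
Proof.
rewrite /rot_tiling -[RHS]imfset_id; apply: eq_imfset => // p.
exact: rot_lozenge6.
Qed.

(** Rotation by 60 degrees has order 6, and [1 + 6 = 2 + (2 + 3)] expresses it by the two given
    rotations. Conversely, closure under it suffices because its inverse is one of its powers. *)
Lemma rot_invariantP (T : tiling) :
  (rot_tiling o 2 T == T) && (rot_tiling o 3 T == T) <->
  (forall l, l \in T -> rot_lozenge o 1 l \in T).
Proof.
split=> [/andP[/eqP T2 /eqP T3] l lT|T1].
  have <- : rot_tiling o 1 T = T.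
    have := rot_tilingD 1 6 T; rewrite rot_tiling6 => <-.
    by rewrite -[(1 + 6)%N]/(2 + (2 + 3))%N !rot_tilingD T3 !T2.
  by apply/imfsetP; exists l.
have Tk k l : l \in T -> rot_lozenge o k l \in T.
  elim: k l => [|k IHk] l lT.
    by rewrite -(rot_lozenge6 l) -rot_lozengeD rot_lozenge6.
  by rewrite -addn1 rot_lozengeD; apply/IHk/T1.
have inv k j : (j + k)%N = 6 -> rot_tiling o k T = T.
  move=> jk; apply/fsetP => l; apply/imfsetP/idP => [[l' l'T ->]|lT]; first exact: Tk.
  exists (rot_lozenge o j l); first exact: Tk.
  by rewrite -rot_lozengeD addnC jk rot_lozenge6.
by rewrite (inv 2 4) // (inv 3 3) // eqxx.
Qed.

Definition next_dir (k : nat) : nat := if k == 2 then 0%N else k.+1.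

Lemma rot_point1 (x y x' y' : int) : x' = N%:Z - y -> y' = x + y ->
  rot_point o 1 (x, y) = (x', y').
Proof. by move=> -> ->; rewrite /rot_point /mulw /=; congr pair => /=; ring. Qed.

Lemma rot_cup x y : rot_triangle o 1 (cup N x y) = cdn N (- y - 1) (x + y).
Proof.
rewrite /rot_triangle /cup /cdn /up /dn imfset_fset3.
rewrite (@rot_point1 _ _ (- y - 1 + 1) (x + y + N%:Z)); [|ring|ring].
rewrite (@rot_point1 _ _ (- y - 1 + 1) (x + y + N%:Z + 1)); [|ring|ring].
rewrite (@rot_point1 _ _ (- y - 1) (x + y + N%:Z + 1)); [|ring|ring].
by apply/fsetP => p; rewrite !inE orbAC.
Qed.

Lemma rot_cdn x y : rot_triangle o 1 (cdn N x y) = cup N (- y - 1) (x + y + 1).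
Proof.
rewrite /rot_triangle /cup /cdn /up /dn imfset_fset3.
rewrite (@rot_point1 _ _ (- y - 1 + 1) (x + y + 1 + N%:Z)); [|ring|ring].
rewrite (@rot_point1 _ _ (- y - 1) (x + y + 1 + N%:Z)); [|ring|ring].
rewrite (@rot_point1 _ _ (- y - 1) (x + y + 1 + N%:Z + 1)); [|ring|ring].
by congr (_ `|` _); rewrite fsetUC.
Qed.

(** The rotation exchanges the orientations, so the upward half of the image comes from the downward
    half of the lozenge. *)
Lemma rot_cloz x y k : (k < 3)%N -> rot_lozenge o 1 (cloz N x y k) =
  cloz N (dy k - y - 1) (x - dx k + y - dy k + 1) (next_dir k).
Proof.
move=> k3; rewrite /rot_lozenge /cloz imfset_fset2 rot_cup rot_cdn fsetUC.
have -> : - y - 1 = dy k - y - 1 - dx (next_dir k).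
  by case: k k3 => [|[|[]]] //= _; rewrite /dx /dy /=; ring.
have -> : x + y = x - dx k + y - dy k + 1 - dy (next_dir k).
  by case: k k3 => [|[|[]]] //= _; rewrite /dx /dy /=; ring.
have -> : - (y - dy k) - 1 = dy k - y - 1 by ring.
by have -> : x - dx k + (y - dy k) + 1 = x - dx k + y - dy k + 1 by ring.
Qed.

End Rotation.

(* Ring [h] of the sextant consists of the upward triangles with [x + y = h]. *)
Definition dir_row (F : nat -> nat -> nat) h := mkseq (fun y => F (h - y)%N y) h.+1.

Fixpoint dir_rows F h := if h is h'.+1 then dir_row F h' :: dir_rows F h' else [::].

Definition particles (r : seq nat) : bitseq := [seq d != 0%N | d <- r].

(** [F x y] is the direction at the upward triangle [(x, y)] of the sextant. [dv_glue] matches the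
    two sides of the sextant; [dv_next] and [dv_compat] together say that a downward triangle is
    covered exactly once. *)
Record dir_valid (F : nat -> nat -> nat) h : Prop := DirValid {
  dv_lt3 : forall x y, (x + y < h)%N -> (F x y < 3)%N;
  dv_glue : forall x, (x < h)%N -> (F x 0%N == 1%N) = (F 0%N x == 2);
  dv_next : forall x y, (x + y.+1 < h)%N ->
    (F x y != 0%N) = (F x.+1 y == 2) || (F x y.+1 == 1%N);
  dv_compat : forall x y, (x + y.+1 < h)%N -> compat (F x.+1 y) (F x y.+1) }.

Lemma dir_validS F h : dir_valid F h.+1 -> dir_valid F h.
Proof.
case=> lt3 glue next comp; split=> *;
  [apply: lt3 | apply: glue | apply: next | apply: comp]; exact: ltnW.
Qed.

Lemma size_dir_row F h : size (dir_row F h) = h.+1.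
Proof. exact: size_mkseq. Qed.

Lemma nth_dir_row F h y : (y <= h)%N -> nth 0%N (dir_row F h) y = F (h - y)%N y.
Proof. by move=> le_yh; rewrite nth_mkseq. Qed.

Lemma glued_dir_row F h :
  glued (dir_row F h) = ((F h 0%N == 1%N) == (F 0%N h == 2)).
Proof.
rewrite /glued -nth0 nth_dir_row // subn0 -nth_last size_dir_row /=.
by rewrite nth_dir_row // subnn.
Qed.

Lemma nth_inner r y : (y.+1 < size r)%N ->
  nth false (inner r) y = (nth 0%N r y == 2) || (nth 0%N r y.+1 == 1%N).
Proof. by case: r => //= d r lt_y; rewrite (nth_pairmap 0%N). Qed.

Lemma inner_dir_row F h : dir_valid F h.+2 ->
  inner (dir_row F h.+1) = particles (dir_row F h).
Proof.
move=> vF; apply: (@eq_from_nth _ false).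
  by rewrite size_inner /particles size_map !size_dir_row.
move=> y; rewrite size_inner size_dir_row -[_.-1]/h.+1 => lt_y.
rewrite /particles (nth_map 0%N) ?size_dir_row // nth_inner ?size_dir_row //.
rewrite !nth_dir_row //; last by rewrite ltnW.
by rewrite subSS (dv_next vF) ?subSn //; lia.
Qed.

Lemma sorted_dir_row F h : dir_valid F h.+1 -> sorted compat (dir_row F h).
Proof.
move=> vF; apply/(sortedP 0%N) => y; rewrite size_dir_row => lt_y.
rewrite !nth_dir_row //; last by rewrite ltnW.
rewrite (_ : h - y = (h - y.+1).+1)%N; last by lia.
by apply: (dv_compat vF); lia.
Qed.

Lemma stacksP h c st : reflect
  (exists r st', [/\ r \in rows c, sorted compat r && glued r,
                     st' \in stacks h (inner r) & st = r :: st'])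
  (st \in stacks h.+1 c).
Proof.
apply: (iffP flattenP) => [[_ /mapP[r r_in ->] /mapP[st' st'_in ->]]|].
  by move: r_in; rewrite mem_filter => /andP[? ?]; exists r, st'.
case=> r [st' [r_in r_ok st'_in ->]].
exists [seq r :: st0 | st0 <- stacks h (inner r)]; last exact: map_f.
by apply/mapP; exists r; rewrite ?mem_filter ?r_ok.
Qed.

Lemma dir_row_rows F h : dir_valid F h.+1 -> dir_row F h \in rows (particles (dir_row F h)).
Proof.
move=> vF; apply: mem_rows; apply/(all_nthP 0%N) => y; rewrite size_dir_row => lt_y.
by rewrite nth_dir_row //; apply: (dv_lt3 vF); lia.
Qed.

Lemma dir_rows_stack F h : dir_valid F h.+1 ->
  dir_rows F h.+1 \in stacks h.+1 (particles (dir_row F h)).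
Proof.
elim: h => [|h IHh] vF; apply/stacksP.
  exists (dir_row F 0), [::]; split=> //; first exact: dir_row_rows.
  by rewrite sorted_dir_row // glued_dir_row (dv_glue vF) // eqxx.
exists (dir_row F h.+1), (dir_rows F h.+1); split=> //; first exact: dir_row_rows.
  by rewrite sorted_dir_row // glued_dir_row (dv_glue vF) // eqxx.
by rewrite inner_dir_row //; apply/IHh/dir_validS.
Qed.

Lemma eq_dir_rows F G h : (forall x y, (x + y < h)%N -> F x y = G x y) ->
  dir_rows F h = dir_rows G h.
Proof.
elim: h => //= h IHh eqFG; rewrite IHh => [|x y lt_h]; last by rewrite eqFG // ltnW.
congr (_ :: _); apply/eq_in_map => y; rewrite mem_iota => lt_y.
by apply: eqFG; lia.
Qed.

(** The last clause carries the induction: it identifies [inner r] with the particles of the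
    outermost ring already built. *)
Lemma stack_dir_rows h c st : st \in stacks h c -> size c = h ->
  exists F, [/\ dir_valid F h, st = dir_rows F h &
             (0 < h)%N -> c = particles (dir_row F h.-1)].
Proof.
elim: h c st => [|h IHh] c st; first by rewrite inE => /eqP-> _; exists (fun _ _ => 0%N).
case/stacksP => r [st' [r_in /andP[r_sorted r_glued] st'_in ->]] sz_c.
have sz_r : size r = h.+1 by rewrite (size_rows r_in).
have [r_c r3] := rows_mapE r_in.
have [F [vF st'E cE]] := IHh _ _ st'_in (ltac:(by rewrite size_inner sz_r)).
pose G x y := if (x + y == h)%N then nth 0%N r y else F x y.
have rowG : dir_row G h = r.
  apply: (@eq_from_nth _ 0%N); first by rewrite size_dir_row.
  by move=> y; rewrite size_dir_row => lt_y; rewrite nth_dir_row // /G subnK ?eqxx.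
have GF x y : (x + y < h)%N -> G x y = F x y by rewrite /G; case: eqP => //; lia.
have Gr x y : (x + y = h)%N -> G x y = nth 0%N r y by rewrite /G => ->; rewrite eqxx.
exists G; split=> /=.
- split=> [x y|x|x y|x y]; rewrite ltnS leq_eqVlt => /predU1P[xy|lt_h].
  + by rewrite Gr //; apply: (allP r3); apply: mem_nth; lia.
  + by rewrite GF //; apply: (dv_lt3 vF).
  + by have := glued_dir_row G h; rewrite rowG r_glued xy => /esym/eqP.
  + by rewrite !GF ?addn0 //; apply: (dv_glue vF).
  + have h_gt0 : (0 < h)%N by lia.
    rewrite (Gr x.+1 y) ?(Gr x y.+1) //; last by lia.
    rewrite -nth_inner; last by rewrite sz_r; lia.
    rewrite (cE h_gt0) /particles (nth_map 0%N) ?size_dir_row; last by lia.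
    by rewrite nth_dir_row ?GF; [congr (F _ _ != _); lia | lia | lia].
  + by rewrite !GF ?(dv_next vF) //; lia.
  + rewrite (Gr x.+1 y) ?(Gr x y.+1) //; last by lia.
    by have /(sortedP 0%N) := r_sorted; apply; rewrite sz_r -xy ltnS leq_addl.
  by rewrite (GF x.+1 y) ?(GF x y.+1); [apply: (dv_compat vF) | lia | lia].
- by rewrite rowG st'E; congr (_ :: _); apply: eq_dir_rows => x y /GF.
by rewrite -[_ :: _]/(particles (dir_row G h)) rowG /particles r_c.
Qed.

(* A lozenge, by its upward triangle and the direction. *)
Definition pos := (int * int * nat)%type.

Definition rot_pos (a : pos) : pos :=
  let: (x, y, k) := a in
  (dy k - y - 1, x - dx k + y - dy k + 1, next_dir k).

Lemma next_dir_lt3 k : (k < 3)%N -> (next_dir k < 3)%N.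
Proof. by case: k => [|[|[]]]. Qed.

Lemma rot_pos6 x y k : (k < 3)%N -> iter 6 rot_pos (x, y, k) = (x, y, k).
Proof. by case: k => [|[|[]]] //= _; congr (_, _, _); rewrite /dx /dy /=; ring. Qed.

(** * Spreading a filling of the sextant over the hexagon *)

Section Orbit.
Variables (N : nat) (F : nat -> nat -> nat).
Hypotheses (vF : dir_valid F N)
  (F_outer : forall x y, (x + y).+1 = N -> F x y != 0%N).

Definition orbit_pos (a : pos) : Prop := exists r x y : nat,
  (x + y < N)%N /\ a = iter r rot_pos (x%:Z, y%:Z, F x y).

Lemma iter_rot_lt3 r x y k : (k < 3)%N -> ((iter r rot_pos (x, y, k)).2 < 3)%N.
Proof.
move=> k3; elim: r => // r; rewrite iterS.
by case: (iter r rot_pos _) => [[z w] j]; apply: next_dir_lt3.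
Qed.

Lemma orbit_pos_lt3 x y k : orbit_pos (x, y, k) -> (k < 3)%N.
Proof.
case=> r [z [w [zwN e]]]; rewrite -[k]/((x, y, k).2) e.
exact/iter_rot_lt3/(dv_lt3 vF).
Qed.

Lemma orbit_pos_rot a : orbit_pos a -> orbit_pos (rot_pos a).
Proof. by case=> r [x [y [xyN ->]]]; exists r.+1, x, y. Qed.

Lemma orbit_pos_unrot x y k : (k < 3)%N -> orbit_pos (rot_pos (x, y, k)) -> orbit_pos (x, y, k).
Proof.
move=> k3 [r [z [w [zwN e]]]]; exists (5 + r)%N, z, w; split=> //.
by rewrite iterD -e -iterSr rot_pos6.
Qed.

Lemma orbit_pos_reduce a : orbit_pos a -> exists r x y : nat,
  [/\ (r < 6)%N, (x + y < N)%N & a = iter r rot_pos (x%:Z, y%:Z, F x y)].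
Proof.
case=> r [x [y [xyN ->]]]; exists (r %% 6)%N, x, y; rewrite ltn_mod; split=> //.
rewrite {1}(divn_eq r 6) addnC iterD; congr (iter _ _ _).
elim: (r %/ 6)%N => // q IHq; rewrite mulSnr iterD rot_pos6 //.
exact: (dv_lt3 vF).
Qed.

(** A turned lozenge re-enters the sextant only across a side: one turn takes direction 1 at
    [(z, 0)] to direction 2 at [(0, z)], five turns do the reverse. [dv_glue] says that [F] already
    agrees with these images. *)
Lemma orbit_pos_sextant (x y k : nat) : (x + y < N)%N ->
  orbit_pos (x%:Z, y%:Z, k) <-> F x y = k.
Proof.
move=> xyN; split=> [/orbit_pos_reduce|<-]; last by exists 0%N, x, y.
case=> r [z [w [r6 zwN]]].
have := dv_lt3 vF zwN; have := dv_glue vF; move Ek: (F z w) => j glue j3.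
case: r r6 => [|[|[|[|[|[|//]]]]]] _.
all: case: j j3 Ek => [|[|[|//]]] _ Ek [].
all: rewrite /dx /dy /= => ex ey ek.
all: try (by exfalso; lia).
all: try (by move: Ek; rewrite ex ey ek).
  have [w0 x0 yz] : [/\ w = 0, x = 0 & y = z]%N by split; lia.
  subst w x y k; rewrite addn0 in zwN.
  by have := glue z zwN; rewrite Ek eqxx => /esym/eqP.
have [z0 y0 xw] : [/\ z = 0, y = 0 & x = w]%N by split; lia.
subst z x y k; rewrite add0n in zwN.
by have := glue w zwN; rewrite Ek eqxx => /eqP.
Qed.

Definition one_up (x y : int) := exists k, [/\ (k < 3)%N, orbit_pos (x, y, k) &
  forall j, orbit_pos (x, y, j) -> j = k].
Definition one_dn (x y : int) := exists k, [/\ (k < 3)%N, orbit_pos (x + dx k, y + dy k, k) &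
  forall j, orbit_pos (x + dx j, y + dy j, j) -> j = k].

Lemma one_up_sextant (x y : nat) : (x + y < N)%N -> one_up x%:Z y%:Z.
Proof.
move=> xyN; exists (F x y); split; first exact: (dv_lt3 vF).
  exact/orbit_pos_sextant.
by move=> j /orbit_pos_sextant => /(_ xyN) ->.
Qed.

Lemma orbit_pos_dn (x y k : nat) : (x + y.+1 < N)%N -> (k < 3)%N ->
  orbit_pos (x%:Z + dx k, y%:Z + dy k, k) <->
  F (x + (k == 2))%N (y + (k == 1%N))%N = k.
Proof.
move=> xyN k3; rewrite /dx /dy -!PoszD; apply: orbit_pos_sextant.
by case: k k3 => [|[|[]]] //= _; lia.
Qed.

Lemma one_dn_sextant (x y : nat) : (x + y.+1 < N)%N -> one_dn x%:Z y%:Z.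
Proof.
move=> xyN; have := dv_next vF xyN; have := dv_compat vF xyN.
rewrite /compat => comp next.
have [k [k3 Fk Funiq]] : exists k, [/\ (k < 3)%N, F (x + (k == 2))%N (y + (k == 1%N))%N = k &
    forall j, (j < 3)%N -> F (x + (j == 2))%N (y + (j == 1%N))%N = j -> j = k].
  case: (eqVneq (F x.+1 y) 2) comp next => [e2 /= ne1 /= ne0|ne2 _ /=].
    exists 2; split; rewrite ?addn1 ?addn0 // => -[|[|[|//]]] //= _;
      rewrite ?addn0 ?addn1 => e; first by rewrite e in ne0.
    by rewrite e in ne1.
  case: (eqVneq (F x y.+1) 1%N) => [e1 ne0|ne1 e0].
    exists 1%N; split; rewrite ?addn1 ?addn0 // => -[|[|[|//]]] //= _;
      rewrite ?addn0 ?addn1 => e; first by rewrite e in ne0.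
    by rewrite e in ne2.
  exists 0%N; split; rewrite ?addn0 //; first by apply/eqP/negbFE.
  move=> -[|[|[|//]]] //= _; rewrite ?addn0 ?addn1 => e.
    by rewrite e in ne1.
  by rewrite e in ne2.
exists k; split=> //; first exact/(orbit_pos_dn xyN k3).
by move=> j oj; have j3 := orbit_pos_lt3 oj; apply: (Funiq j j3); apply/(orbit_pos_dn xyN j3).
Qed.

Lemma rot_pos_up x y k : (k < 3)%N ->
  rot_pos (x, y, k) = (- y - 1 + dx (next_dir k), x + y + dy (next_dir k), next_dir k).
Proof. by case: k => [|[|[]]] //= _; congr (_, _, _); rewrite /dx /dy /=; ring. Qed.

Lemma rot_pos_dn x y k : (k < 3)%N ->
  rot_pos (x + dx k, y + dy k, k) = (- y - 1, x + y + 1, next_dir k).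
Proof. by case: k => [|[|[]]] //= _; congr (_, _, _); rewrite /dx /dy /=; ring. Qed.

Lemma next_dir_inj j k : (j < 3)%N -> (k < 3)%N -> next_dir j = next_dir k -> j = k.
Proof. by case: j => [|[|[]]]; case: k => [|[|[]]]. Qed.

Lemma next_dir_surj k : (k < 3)%N -> exists2 j, (j < 3)%N & k = next_dir j.
Proof.
by case: k => [|[|[]]] // _; [exists 2 | exists 0%N | exists 1%N].
Qed.

Lemma one_up_rot x y : one_dn (- y - 1) (x + y) -> one_up x y.
Proof.
case=> k' [/next_dir_surj[k k3 ->]]; rewrite -rot_pos_up //.
move=> /(orbit_pos_unrot k3) ok uniq; exists k; split=> // j oj.
have j3 := orbit_pos_lt3 oj; apply: next_dir_inj => //; apply: uniq.
by rewrite -rot_pos_up //; apply: orbit_pos_rot.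
Qed.

Lemma one_dn_rot x y : one_up (- y - 1) (x + y + 1) -> one_dn x y.
Proof.
case=> k' [/next_dir_surj[k k3 ->]]; rewrite -rot_pos_dn //.
move=> /(orbit_pos_unrot k3) ok uniq; exists k; split=> // j oj.
have j3 := orbit_pos_lt3 oj; apply: next_dir_inj => //; apply: uniq.
by rewrite -rot_pos_dn //; apply: orbit_pos_rot.
Qed.

(** The six cases are the sextants. Turns bring each one to the first sextant, and since every turn
    exchanges the orientations, their parity decides whether [up0] or [dn0] finishes. *)
Lemma one_up_in x y : in_up N x y -> one_up x y.
Proof.
have up0 (z w : int) : 0 <= z -> 0 <= w -> z + w < N%:Z -> one_up z w.
  by case: z => // z; case: w => // w _ _ lt_N; apply: one_up_sextant; lia.
have dn0 (z w : int) : 0 <= z -> 0 <= w -> z + w + 1 < N%:Z -> one_dn z w.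
  by case: z => // z; case: w => // w _ _ lt_N; apply: one_dn_sextant; lia.
rewrite /in_up => xyN.
have [[]|[[]|[[]|[[]|[[]|[]]]]]] : 0 <= x /\ 0 <= y \/ 0 <= - y - 1 /\ 0 <= x + y \/
    0 <= - x - y - 1 /\ 0 <= x \/ 0 <= - x - 1 /\ 0 <= - y - 1 \/
    0 <= y /\ 0 <= - x - y - 1 \/ 0 <= x + y /\ 0 <= - x - 1 by lia.
- by move=> ? ?; apply: up0 => //; lia.
- by move=> ? ?; apply: one_up_rot; apply: dn0; lia.
- by move=> ? ?; apply: one_up_rot; apply: one_dn_rot; apply: up0; lia.
- by move=> ? ?; apply: one_up_rot; apply: one_dn_rot; apply: one_up_rot; apply: dn0; lia.
- by move=> ? ?; do 2!(apply: one_up_rot; apply: one_dn_rot); apply: up0; lia.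
by move=> ? ?; do 2!(apply: one_up_rot; apply: one_dn_rot); apply: one_up_rot; apply: dn0; lia.
Qed.

Lemma one_dn_in x y : in_dn N x y -> one_dn x y.
Proof. by rewrite /in_dn => xyN; apply/one_dn_rot/one_up_in; rewrite /in_up; lia. Qed.

Lemma orbit_pos_in x y k : orbit_pos (x, y, k) ->
  in_up N x y /\ in_dn N (x - dx k) (y - dy k).
Proof.
case=> r [z [w [zwN]]]; have j3 := dv_lt3 vF zwN.
elim: r x y k => [|r IHr] x y k.
  case=> -> -> ->; rewrite /in_up /in_dn; split; first by lia.
  (* Within the sextant only direction 0 on the outermost ring crosses the boundary of the
     hexagon. *)
  have outer : (z + w).+1 = N -> F z w <> 0%N by move=> /F_outer/eqP.
  by move: outer j3; rewrite /dx /dy; move: (F z w) => j; lia.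
rewrite iterS; have := iter_rot_lt3 r z%:Z w%:Z j3.
case E: (iter r rot_pos _) => [[x' y'] k'] k'3 [-> -> ->].
have [] := IHr x' y' k' (esym E).
rewrite /in_up /in_dn; case: k' k'3 {E} => [|[|[|//]]] _; rewrite /dx /dy /=; lia.
Qed.

End Orbit.

(** * Bijection between invariant tilings and stacks *)

Section Counting.
Variable N : nat.
Let o := hexagon_center N.

Definition loz_at (a : pos) : lozenge := cloz N a.1.1 a.1.2 a.2.

Lemma rot_loz_at a : (a.2 < 3)%N -> rot_lozenge o 1 (loz_at a) = loz_at (rot_pos a).
Proof. by case: a => [[x y] k] /= k3; rewrite /loz_at rot_cloz. Qed.

Definition orbit_seq (F : nat -> nat -> nat) : seq pos :=
  [seq iter q.1 rot_pos (q.2.1%:Z, q.2.2%:Z, F q.2.1 q.2.2) |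
   q <- [seq (r, p) | r <- iota 0 6, p <- [seq (x, y) | x <- iota 0 N, y <- iota 0 N]]
   & (q.2.1 + q.2.2 < N)%N].

Lemma mem_orbit_seq F a : dir_valid F N -> reflect (orbit_pos N F a) (a \in orbit_seq F).
Proof.
move=> vF; apply: (iffP mapP) => [[[r [x y]]]|/(orbit_pos_reduce vF)].
  by rewrite mem_filter => /andP[xyN _] ->; exists r, x, y.
case=> r [x [y [r6 xyN ->]]]; exists (r, (x, y)) => //.
rewrite mem_filter xyN andTb; apply/allpairsP; exists (r, (x, y)); split=> //.
  by rewrite mem_iota.
by apply/allpairsP; exists (x, y); split; rewrite // mem_iota /=; lia.
Qed.

Definition orbit_tiling F : tiling := [fset loz_at a | a in orbit_seq F].

Definition cssc_tiling (T : tiling) :=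
  hexagon_tiling N T /\ forall l, l \in T -> rot_lozenge o 1 l \in T.

Section FromDirections.
Variable F : nat -> nat -> nat.
Hypotheses (vF : dir_valid F N)
  (F_outer : forall x y, (x + y).+1 = N -> F x y != 0%N).

Lemma mem_orbit_tiling x y k : (k < 3)%N ->
  cloz N x y k \in orbit_tiling F <-> orbit_pos N F (x, y, k).
Proof.
move=> k3; split=> [/imfsetP[[[z w] j] /= /(mem_orbit_seq _ vF) oj eq_l]|ok].
  by have [-> -> ->] := cloz_inj k3 (orbit_pos_lt3 vF oj) eq_l.
by apply/imfsetP; exists (x, y, k) => //; apply/mem_orbit_seq.
Qed.

Lemma orbit_tiling_cssc : cssc_tiling (orbit_tiling F).
Proof.
split=> [|l /imfsetP[a /= /(mem_orbit_seq _ vF) oa ->]]; last first.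
  have a3 : (a.2 < 3)%N by case: a oa => [[x y] k]; apply: orbit_pos_lt3.
  rewrite rot_loz_at //; apply/imfsetP; exists (rot_pos a) => //=.
  by apply/mem_orbit_seq => //; apply: orbit_pos_rot.
split.
- move=> l /imfsetP[[[x y] k] /= /(mem_orbit_seq _ vF) oa ->].
  by exists x, y, k; split=> //; apply: orbit_pos_lt3 oa.
- by move=> x y k k3 /(mem_orbit_tiling _ _ k3); apply: orbit_pos_in.
- move=> x y /(one_up_in vF)[k [k3 ok _]]; exists k => //.
  exact/mem_orbit_tiling.
- move=> x y k j k3 j3 /(mem_orbit_tiling _ _ k3) ok /(mem_orbit_tiling _ _ j3) oj.
  have [|i [_ _ uniq]] := one_up_in vF (x := x) (y := y).
    by have [] := orbit_pos_in vF F_outer ok.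
  by rewrite (uniq _ ok) (uniq _ oj).
- move=> x y /(one_dn_in vF)[k [k3 ok _]]; exists k => //.
  exact/mem_orbit_tiling.
move=> x y k j k3 j3 /(mem_orbit_tiling _ _ k3) ok /(mem_orbit_tiling _ _ j3) oj.
have [|i [_ _ uniq]] := one_dn_in vF (x := x) (y := y).
  by have [_] := orbit_pos_in vF F_outer ok; rewrite !addrK.
by rewrite (uniq _ ok) (uniq _ oj).
Qed.

End FromDirections.

Definition dir_of (T : tiling) (x y : nat) : nat :=
  if cloz N x%:Z y%:Z 0 \in T then 0%N else
  if cloz N x%:Z y%:Z 1 \in T then 1%N else 2.

Lemma in_up_sextant (x y : nat) : (x + y < N)%N -> in_up N x%:Z y%:Z.
Proof. by rewrite /in_up; lia. Qed.

Lemma dir_ofE T (x y k : nat) : hexagon_tiling N T -> (x + y < N)%N -> (k < 3)%N ->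
  (dir_of T x y == k) = (cloz N x%:Z y%:Z k \in T).
Proof.
move=> tT xyN k3.
have [j j3 jT] := ht_up tT (in_up_sextant xyN).
have memE i : (i < 3)%N -> (cloz N x%:Z y%:Z i \in T) = (i == j).
  move=> i3; apply/idP/eqP => [iT|-> //]; exact: ht_up_uniq tT _ _ _ _ i3 j3 iT jT.
rewrite /dir_of (memE 0%N isT) (memE 1%N isT) (memE k k3).
by case: j j3 {jT memE} => [|[|[|//]]] _; case: k k3 => [|[|[|//]]].
Qed.

Section FromTiling.
Variable T : tiling.
Hypothesis cT : cssc_tiling T.
Let tT : hexagon_tiling N T := cT.1.

Lemma cssc_iter r x y k : (k < 3)%N -> cloz N x y k \in T ->
  loz_at (iter r rot_pos (x, y, k)) \in T.
Proof.
move=> k3 kT; elim: r => [|r IHr]; first exact: kT.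
by rewrite iterS -rot_loz_at; [apply: cT.2 | apply: iter_rot_lt3].
Qed.

Lemma only_one_dir (j : nat) (b0 b1 b2 : bool) : (j < 3)%N ->
    b0 = (0%N == j) -> b1 = (1%N == j) -> b2 = (2 == j) ->
  ~~ b0 = b2 || b1 /\ ~~ (b2 && b1).
Proof. by case: j => [|[|[|//]]] _ -> -> ->. Qed.

Lemma dir_of_next (x y : nat) : (x + y.+1 < N)%N ->
  (dir_of T x y != 0%N) = (dir_of T x.+1 y == 2) || (dir_of T x y.+1 == 1%N) /\
  compat (dir_of T x.+1 y) (dir_of T x y.+1).
Proof.
move=> xyN; have lt10 : (x.+1 + y < N)%N by lia.
have lt00 : (x + y < N)%N by lia.
have [j j3 jT] : exists2 k, (k < 3)%N & cloz N (x%:Z + dx k) (y%:Z + dy k) k \in T.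
  by apply: (ht_dn tT); rewrite /in_dn; lia.
have memE i : (i < 3)%N -> (cloz N (x%:Z + dx i) (y%:Z + dy i) i \in T) = (i == j).
  by move=> i3; apply/idP/eqP => [iT|-> //]; apply: ht_dn_uniq tT _ _ _ _ i3 j3 iT jT.
have c0 : cloz N x%:Z y%:Z 0 = cloz N (x%:Z + dx 0) (y%:Z + dy 0) 0 by rewrite !addr0.
have S1 (z : nat) : z.+1%:Z = z%:Z + 1 by rewrite -addn1 PoszD.
have c1 : cloz N x%:Z y.+1%:Z 1 = cloz N (x%:Z + dx 1) (y%:Z + dy 1) 1.
  by rewrite addr0 S1.
have c2 : cloz N x.+1%:Z y%:Z 2 = cloz N (x%:Z + dx 2) (y%:Z + dy 2) 2.
  by rewrite addr0 S1.
pose inT l := l \in T.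
have e0 := etrans (@dir_ofE T x y 0 tT lt00 isT) (etrans (congr1 inT c0) (memE 0%N isT)).
have e1 := etrans (@dir_ofE T x y.+1 1 tT xyN isT) (etrans (congr1 inT c1) (memE 1%N isT)).
have e2 := etrans (@dir_ofE T x.+1 y 2 tT lt10 isT) (etrans (congr1 inT c2) (memE 2 isT)).
exact: only_one_dir j3 e0 e1 e2.
Qed.

Lemma dir_of_valid : dir_valid (dir_of T) N.
Proof.
split=> [x y _|x xN|x y /dir_of_next[] //|x y /dir_of_next[] //].
  by rewrite /dir_of; case: ifP => // _; case: ifP.
have rot_glue : rot_pos (x%:Z, 0, 1%N) = (0, x%:Z, 2).
  by congr (_, _, _); rewrite /dx /dy /=; ring.
have xN' : (x + 0 < N)%N by rewrite addn0.
rewrite (@dir_ofE T x 0 1 tT xN' isT) (@dir_ofE T 0 x 2 tT xN isT).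
apply/idP/idP => [/(@cssc_iter 1 _ _ 1 isT)|/(@cssc_iter 5 _ _ 2 isT)].
  by rewrite iterS rot_glue.
by rewrite -rot_glue -iterSr rot_pos6.
Qed.

Lemma dir_of_outer x y : (x + y).+1 = N -> dir_of T x y != 0%N.
Proof.
move=> xyN; rewrite dir_ofE //; last by lia.
by apply/negP => /(@ht_in _ _ tT _ _ 0 isT)[_]; rewrite /in_dn /dx /dy /=; lia.
Qed.

(** Invariance puts the whole orbit into [T]. Conversely, an orbit lozenge covers the upward
    triangle of any given lozenge of [T], and uniqueness in [T] identifies the two. *)
Lemma mem_cssc x y k : (k < 3)%N -> cloz N x y k \in T <-> orbit_pos N (dir_of T) (x, y, k).
Proof.
have orbT a : orbit_pos N (dir_of T) a -> loz_at a \in T.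
  case=> r [z [w [zwN ->]]]; apply: cssc_iter; first exact: (dv_lt3 dir_of_valid).
  by rewrite -dir_ofE //; apply: (dv_lt3 dir_of_valid).
move=> k3; split=> [kT|/orbT //].
have [xy_in _] := ht_in tT k3 kT.
have [j [j3 oj _]] := one_up_in dir_of_valid xy_in.
by rewrite (ht_up_uniq tT k3 j3 kT (orbT _ oj)).
Qed.

End FromTiling.

Lemma dir_rows_inj F G h : dir_rows F h = dir_rows G h ->
  forall x y, (x + y < h)%N -> F x y = G x y.
Proof.
elim: h => // h IHh eq_rows x y lt_h.
have eq_row : dir_row F h = dir_row G h := congr1 (head [::]) eq_rows.
have [xy|ne_xy] := eqVneq (x + y)%N h; last by apply: IHh (congr1 behead eq_rows) _ _ _; lia.
have := congr1 (nth 0%N ^~ y) eq_row.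
by rewrite !nth_dir_row -xy ?leq_addl // addnK.
Qed.

Lemma cssc_tiling_inj T1 T2 : cssc_tiling T1 -> cssc_tiling T2 ->
  dir_rows (dir_of T1) N = dir_rows (dir_of T2) N -> T1 = T2.
Proof.
wlog suff sub : T1 T2 / cssc_tiling T1 -> cssc_tiling T2 ->
    dir_rows (dir_of T1) N = dir_rows (dir_of T2) N -> T1 `<=` T2.
  by move=> c1 c2 e; apply/eqP; rewrite eqEfsubset !sub.
move=> c1 c2 /dir_rows_inj eq_dir; apply/fsubsetP => l lT1.
have [x [y [k [k3 l_eq]]]] := ht_lozenge c1.1 lT1; rewrite l_eq in lT1 *.
move/(mem_cssc c1 _ _ k3): lT1 => [r [z [w [zwN e]]]].
by apply/(mem_cssc c2 _ _ k3); exists r, z, w; rewrite -eq_dir.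
Qed.

Theorem CSSC_stacks : CSSC N = size (stacks N (nseq N true)).
Proof.
rewrite /CSSC; set X := [fset T in _ | _].
have memX T : T \in X <-> cssc_tiling T.
  have -> : (T \in X) = (T \in tilings (hexagon N N N)) &&
      ((rot_tiling o 2 T == T) && (rot_tiling o 3 T == T)) by rewrite !inE.
  split=> [/andP[tT /rot_invariantP rT]|[tT rT]].
    by split=> //; apply/tilingsP.
  by apply/andP; split; [apply/tilingsP | apply/rot_invariantP].
pose s := [seq dir_rows (dir_of T) N | T <- enum_fset X].
have us : uniq s.
  rewrite map_inj_in_uniq ?fset_uniq // => T1 T2 /memX c1 /memX c2.
  exact: cssc_tiling_inj.
have mem_s : s =i stacks N (nseq N true).
  move=> st; apply/mapP/idP => [[T /memX cT ->]|st_in].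
    suff gen M : M = N -> dir_rows (dir_of T) M \in stacks M (nseq M true) by exact: gen.
    case: M => [|h] hN; first by [].
    have vT : dir_valid (dir_of T) h.+1 by rewrite hN; apply: dir_of_valid.
    (* Direction 0 on the outermost ring would leave the hexagon, so every outer position carries a
       particle. *)
    have -> : nseq h.+1 true = particles (dir_row (dir_of T) h).
      apply: (@eq_from_nth _ true).
        by rewrite /particles size_map size_dir_row size_nseq.
      move=> y; rewrite size_nseq => lt_y.
      rewrite nth_nseq lt_y /particles (nth_map 0%N) ?size_dir_row //.
      by rewrite nth_dir_row // (dir_of_outer cT) // subnK.
    exact: dir_rows_stack.
  have [F [vF -> outer]] := stack_dir_rows st_in (size_nseq _ _).
  have F_outer x y : (x + y).+1 = N -> F x y != 0%N.
    move=> xyN; have N_gt0 : (0 < N)%N by rewrite -xyN.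
    have /(congr1 (nth true ^~ y)) := outer N_gt0.
    rewrite nth_nseq if_same /particles (nth_map 0%N) -?xyN ?size_dir_row ?ltnS ?leq_addl //.
    by rewrite nth_dir_row ?leq_addl // addnK.
  have cF := orbit_tiling_cssc vF F_outer.
  exists (orbit_tiling F); first exact/memX.
  apply: eq_dir_rows => x y xyN; apply/esym/eqP.
  rewrite (dir_ofE cF.1 xyN (dv_lt3 vF xyN)).
  by apply/mem_orbit_tiling; rewrite ?(dv_lt3 vF) //; apply/orbit_pos_sextant.
by rewrite -(perm_size (uniq_perm us (uniq_stacks _ _) mem_s)) size_map.
Qed.

End Counting.

Theorem theorem5p1 (n : nat) (hn : (1 <= n)%N) :
  (CSSC (2 * n))%:R =
  (\prod_(0 <= i < n) (((3 * i + 1)`!)%:R / ((n + i)`!)%:R)) ^+ 2 :> rat.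
Proof. by rewrite CSSC_stacks stacks_formula. Qed.
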